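(* Let $a>0$, $s>1$, let $n\ge2$ be an integer, and let $w(x)=|x-ai|^{-s}$ for $x\in\mathbb{R}$. The $n$-point weighted Fekete point set $\mathcal{F}_n^w$ for $w$ on $\mathbb{R}$ is unique, and is given by the roots of the polynomial $$G(x):=x^n+\sum_{k=1}^{\lfloor n/2\rfloor}\left((-1)^k a^{2k}\binom{n}{2k}\frac{(2k-1)!!}{\prod_{j=1}^k(2s(n-1)-2n+2j+1)}\right)x^{n-2k}.$$ Moreover, $$G(x)=\frac{(2ai)^n\,n!}{(n-2s(n-1)-1)_n}\,P_n^{(-s(n-1)-1,\,-s(n-1)-1)}(-ix/a)$$ and $$\delta_n^w(\mathbb{R})=\frac{(2a)^{1-2s}(n!)^{2/n}}{\big|(-s(n-1))_n\big|^{2s/n}}\,\big|(n-2s(n-1)-1)_n\big|^{2(s-1)/n}\left(\prod_{k=1}^n k^{k-2n+2}\,\big|k-s(n-1)-1\big|^{2k-2}\,\big|n+k-2s(n-1)-2\big|^{n-k}\right)^{\frac{1}{n(n-1)}}.$$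
   Context: Here $i$ is the imaginary unit. For a closed set $E\subset\mathbb{C}$, a continuous weight $w:E\to[0,\infty)$ and an integer $n\ge2$, the $n$th weighted diameter is $$\delta_n^w(E):=\sup_{Z_n\subset E}\left(\prod_{1\le j<k\le n}|z_j-z_k|\,w(z_j)w(z_k)\right)^{\frac{2}{n(n-1)}}=\sup_{Z_n\subset E}\left(|V(Z_n)|^{\frac{2}{n(n-1)}}\prod_{k=1}^n w(z_k)^{2/n}\right),$$ where the supremum is over all $n$-point sets $Z_n=\{z_k\}_{k=1}^n\subset E$ and $V(Z_n)=\prod_{1\le j<k\le n}(z_j-z_k)$. A set of $n$ points $\mathcal{F}_n^w\subset E$ that attains this supremum is called an ($n$th) weighted Fekete point set for $w$ on $E$. $(t)_n:=t(t+1)\cdots(t+n-1)$ is the Pochhammer symbol (rising factorial), and $\binom{t}{n}:=\frac{t(t-1)\cdots(t-n+1)}{n!}$ is the generalized binomial coefficient. The Jacobi polynomials are defined, for arbitrary parameters $\alpha,\beta$ (not only $\alpha,\beta>-1$), by $$P_n^{(\alpha,\beta)}(x):=2^{-n}\sum_{k=0}^n\binom{n+\alpha}{n-k}\binom{n+\beta}{k}(x-1)^k(x+1)^{n-k}.$$ *)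

(* Defs.v *)
From HB Require Import structures.
From mathcomp Require Import all_boot all_order all_algebra.
From mathcomp Require Import all_classical all_reals all_analysis.
From mathcomp.real_closed Require Import complex.

Set Implicit Arguments.
Unset Strict Implicit.
Unset Printing Implicit Defensive.

Import Order.TTheory GRing.Theory Num.Theory.

Local Open Scope classical_set_scope.
Local Open Scope ring_scope.
Local Open Scope complex_scope.

(* [`|z|] has type [R[i]] for [z : R[i]]; the real-valued modulus is [normc]. *)
Notation normc := ComplexField.Normc.normc.

Definition real_line (R : realType) : set R[i] := range (real_complex R).
Arguments real_line R : clear implicits.

Section Fekete.
Variables (R : realType) (n : nat) (w : R[i] -> R) (E : set R[i]).

(* Only the values of [w] on [E] matter below. *)
Definition weighted_energy (z : 'I_n -> R[i]) : R :=
  (\prod_(j < n) \prod_(k < n | (j < k)%N)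
      (normc (z j - z k) * w (z j) * w (z k)))
    `^ (2 / (n%:R * (n%:R - 1))).

(* [z] lists, without repetition, the points of the [n]-point set [Z]; the
   energy is symmetric, so it does not depend on the chosen listing. *)
Definition npoint_listing (Z : set R[i]) (z : 'I_n -> R[i]) : Prop :=
  injective z /\ range z = Z.

(* The supremum is taken in the extended reals, so that an equation with a
   finite value also asserts that the supremum is finite. *)
Definition weighted_diameter : \bar R :=
  ereal_sup [set e : \bar R | exists (Z : set R[i]) (z : 'I_n -> R[i]),
    [/\ Z `<=` E, npoint_listing Z z & e = (weighted_energy z)%:E]].

Definition weighted_fekete_set (F : set R[i]) : Prop :=
  F `<=` E /\ exists z : 'I_n -> R[i],
    npoint_listing F z /\ (weighted_energy z)%:E = weighted_diameter.

End Fekete.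

Definition pochhammer (F : pzRingType) (t : F) (n : nat) : F :=
  \prod_(0 <= j < n) (t + j%:R).

Definition gbinom (F : fieldType) (t : F) (n : nat) : F :=
  (\prod_(0 <= j < n) (t - j%:R)) / (n`!)%:R.

Definition jacobi (F : fieldType) (n : nat) (alpha beta : F) : {poly F} :=
  2 ^- n *: \sum_(0 <= k < n.+1)
     (gbinom (n%:R + alpha) (n - k) * gbinom (n%:R + beta) k) *:
       (('X - 1) ^+ k * ('X + 1) ^+ (n - k)).

Fixpoint double_fact (n : nat) : nat :=
  match n with
  | m.+2 => n * double_fact m
  | _ => 1
  end.

Definition fekete_poly (R : realType) (a s : R) (n : nat) : {poly R} :=
  'X^n + \sum_(1 <= k < (n./2).+1)
    ((-1) ^+ k * a ^+ (2 * k) * 'C(n, 2 * k)%:R *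
      ((double_fact (2 * k - 1))%:R /
        \prod_(1 <= j < k.+1)
          (2 * s * (n%:R - 1) - 2 * n%:R + 2 * j%:R + 1))) *: 'X^(n - 2 * k).

(* Main.v *)
Require Import Defs.
From HB Require Import structures.
From mathcomp Require Import all_boot all_order all_algebra.
From mathcomp Require Import ring lra zify.
From mathcomp Require Import all_classical all_reals all_analysis.
From mathcomp.real_closed Require Import complex.

Set Implicit Arguments.
Unset Strict Implicit.
Unset Printing Implicit Defensive.

Import Order.TTheory GRing.Theory Num.Theory.

Local Open Scope ring_scope.

(** Put N = s (n - 1). For real points x_j, the quantity maximized by the n-th
diameter is the power 1 / (n (n - 1)) of
  [sq_energy x] = prod_(j <> k) |x_j - x_k| . prod_j (x_j^2 + a^2)^(-N).

_Shape of a maximizer._ Since s > 1, and because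
  (x - y)^2 a^2 <= (x^2 + a^2) (y^2 + a^2),
the energy tends to 0 as soon as one point escapes to infinity, so a maximum is
attained ([sq_energy_max]). Moving one point x_i of a maximizer and
differentiating gives, for p = prod_k (X - x_k),
  (x_i^2 + a^2) p''(x_i) - 2 N x_i p'(x_i) = 0     ([critical_eq]).
This is Stieltjes' argument: the polynomial
  (X^2 + a^2) p'' - 2 N X p' - n (n - 1 - 2 N) p
has degree less than n, because the eigenvalue cancels its leading term, and it
vanishes at the n points x_i, so it is zero ([maximizer_poly]). Comparing
coefficients, this differential equation has only one monic solution of degree n
([romanovski_op_eq0]), and the explicit polynomial G solves it
([fekete_poly_romanovski_op]). Hence every maximizer lists the roots of that
polynomial. Existence of a maximizer then yields, with no separate argument, both
that these roots are real and simple and that they do form a Fekete set.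

_Jacobi form._ After the substitution x = i a t the equation becomes the Jacobi
equation with alpha = beta = - N - 1, which the defining sum of the Jacobi
polynomial satisfies by a telescoping computation ([jacobi_romanovski_op]). By
uniqueness the two polynomials are proportional, and the factor is found by
evaluating at t = 1, that is at x = i a ([romanovski_jacobi]).

_Value._ Fix N and let H_m be the monic solution of degree m, a Romanovski
polynomial. These satisfy
  H_(m+1) = X H_m - g_m H_(m-1),
  (X^2 + a^2) H_m' = m X H_m + d_m H_(m-1)         ([romanovski_deriv]).
At a root of H_n the second relation turns H_n' into H_(n-1), and Schur's method
computes prod H_(n-1)(x_j) over the roots of H_n from the first one
([romanovski_resultant]); as the H_m with m < n need not be known to split over
the reals, this is done over the complex numbers. At x = i a the second relation
evaluates H_n(i a), hence prod (x_j^2 + a^2). Together they give the discriminant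
and the weight as explicit products ([romanovski_root_products]), which
[disc_identity] and [prod_romanovski_ratio] bring to the stated form by induction
on n with N fixed. *)

(** * The differential operator of the Romanovski polynomials *)

Lemma neq0_eq (V : nmodType) (x y : V) : x != 0 -> x = y -> y != 0.
Proof. by move=> + <-. Qed.

Section Ode.
Variable F : numFieldType.
Implicit Types (b N : F) (p : {poly F}) (n : nat).

(** The eigenvalue is chosen so that the operator lowers the degree of a polynomial
of degree n. The parameter b is a^2 for the Fekete problem and -1 for the Jacobi
equation, which is why it is kept free. *)
Definition romanovski_op b N n p : {poly F} :=
  ('X^2 + b%:P) * p^`()^`() - (2 * N) *: ('X * p^`())
  - (n%:R * (n%:R - 1 - 2 * N)) *: p.

(** The operator couples only coefficients two apart; the factor n - j makes the
diagonal term vanish in degree n. *)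
Lemma coef_romanovski_op b N n p j :
  (romanovski_op b N n p)`_j =
    b * (j%:R + 2) * (j%:R + 1) * p`_j.+2
    + (n%:R - j%:R) * (2 * N + 1 - n%:R - j%:R) * p`_j.
Proof.
rewrite /romanovski_op mulrDl !(coefB, coefD, coefZ, coefXnM, coefCM, coefXM, coef_deriv).
have -> : (if (j < 2)%N then 0 else p`_(j - 2).+2 *+ (j - 2).+2 *+ (j - 2).+1)
    = j%:R * (j%:R - 1) * p`_j.
  case: j => [|[|j]] /=; rewrite ?mul0r ?subrr ?mulr0 ?mul0r //.
  by rewrite !subSS subn0 -mulrnA -[LHS]mulr_natl natrM -[in RHS](natr1 j.+1) addrK natr1.
have -> : (if j == 0%N then 0 else p`_j.-1.+1 *+ j.-1.+1) = j%:R * p`_j.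
  by case: j => [|j] /=; rewrite ?mul0r // mulr_natl.
have -> : p`_j.+2 *+ j.+2 *+ j.+1 = (j%:R + 2) * (j%:R + 1) * p`_j.+2.
  by rewrite -mulrnA -[LHS]mulr_natl natrM -(natrD _ j 2) natr1 addn2.
by move: p`_j p`_j.+2 => u v; ring.
Qed.

Lemma romanovski_op_size b N n p :
  (size p <= n.+1)%N -> (size (romanovski_op b N n p) <= n)%N.
Proof.
move=> sp; apply/leq_sizeP => j lenj; rewrite coef_romanovski_op.
rewrite [p`_j.+2]nth_default ?mulr0 ?add0r; last first.
  by apply: leq_trans sp _; rewrite !ltnS (leq_trans lenj).
have [->|ne] := eqVneq j n; first by rewrite subrr !mul0r.
by rewrite [p`_j]nth_default ?mulr0 // (leq_trans sp) // ltn_neqAle eq_sym ne.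
Qed.

(** The coefficient formula determines each p`_j with j < n from p`_j.+2, so the
leading coefficient determines p. *)
Lemma romanovski_op_eq0 b N n p :
  (forall j, (j < n)%N -> 2 * N + 1 - n%:R - j%:R != 0) ->
  (size p <= n.+1)%N -> romanovski_op b N n p = 0 -> p`_n = 0 -> p = 0.
Proof.
move=> hN sp hp pn.
have step m : (forall j, (n <= j + m)%N -> p`_j = 0).
  elim: m => [|m IH] j.
    rewrite addn0 leq_eqVlt => /predU1P[<-//|ltnj].
    by rewrite nth_default // (leq_trans sp).
  rewrite addnS leq_eqVlt => /predU1P[nE|]; last by rewrite ltnS; exact: IH.
  have := coef_romanovski_op b N n p j; rewrite hp coef0 IH; last by rewrite nE; lia.
  rewrite mulr0 add0r => /esym/eqP; rewrite !mulf_eq0 => /orP[/orP[]|/eqP//].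
    by rewrite subr_eq0 eqr_nat => /eqP; lia.
  by have /negPf-> := hN j ltac:(lia).
by apply/polyP => j; rewrite coef0; apply: (step n); rewrite leq_addl.
Qed.

Lemma romanovski_op0 b N n : romanovski_op b N n 0 = 0.
Proof. by rewrite /romanovski_op !(derivC, mulr0, scaler0, subr0). Qed.

Lemma romanovski_opD b N n p q :
  romanovski_op b N n (p + q) = romanovski_op b N n p + romanovski_op b N n q.
Proof. by apply/polyP=> j; rewrite [RHS]coefD !coef_romanovski_op coefD coefD; ring. Qed.

Lemma romanovski_opB b N n p q :
  romanovski_op b N n (p - q) = romanovski_op b N n p - romanovski_op b N n q.
Proof. by apply/polyP=> j; rewrite [RHS]coefB !coef_romanovski_op coefB coefB; ring. Qed.

Lemma romanovski_opZ b N n c p : romanovski_op b N n (c *: p) = c *: romanovski_op b N n p.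
Proof. by apply/polyP=> j; rewrite [RHS]coefZ !coef_romanovski_op coefZ coefZ; ring. Qed.

End Ode.

(** * Romanovski polynomials: recurrence, derivative, resultant *)

Section Rec.
Variables (F : numFieldType) (b N : F).
Implicit Types (m n : nat).

(** [romanovski_ratio m] is H_m(c) / (c H_(m-1)(c)) at a root c of X^2 + b;
[romanovski_lower] and [romanovski_rec] are the d_m and g_m of the
differentiation formula and of the three-term recurrence. *)
Definition romanovski_ratio m : F := (2 * N + 2 - m%:R) / (2 * N + 3 - 2 * m%:R).
Definition romanovski_lower m : F := b * m%:R * romanovski_ratio m.
Definition romanovski_rec m : F := romanovski_lower m / (2 * N + 1 - 2 * m%:R).

Fixpoint romanovski m : {poly F} :=
  match m with
  | 0 => 1
  | 1 => 'X
  | (k.+1 as k1).+1 => 'X * romanovski k1 - romanovski_rec k1 *: romanovski k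
  end.

Lemma romanovskiSS m :
  romanovski m.+2 = 'X * romanovski m.+1 - romanovski_rec m.+1 *: romanovski m.
Proof. by []. Qed.

Lemma romanovski_monic_size m : romanovski m \is monic /\ size (romanovski m) = m.+1.
Proof.
have [] : (romanovski m \is monic /\ size (romanovski m) = m.+1) /\
  (romanovski m.+1 \is monic /\ size (romanovski m.+1) = m.+2); last by [].
elim: m => [|m [[mo0 s0] [mo1 s1]]].
  by rewrite /= monic1 monicX size_poly1 size_polyX.
split=> //; rewrite romanovskiSS.
have sX : size ('X * romanovski m.+1) = m.+3.
  by rewrite mulrC size_mulX ?monic_neq0 // s1.
have lt : (size (- (romanovski_rec m.+1 *: romanovski m)) < size ('X * romanovski m.+1)%R)%N.
  by rewrite sX size_polyN (leq_ltn_trans (size_scale_leq _ _)) // s0.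
split; last by rewrite size_polyDl.
by rewrite monicE lead_coefDl // mulrC lead_coefMX -monicE.
Qed.

(** The two ways of writing (X^2 + b) H_m': through H_(m+1) and, for the next
index, through H_m. Carrying both makes the induction close without dividing by
the recurrence coefficients: the derivative of the recurrence for H_(m+2) uses the
second formula for H_(m+1) and the first one for H_m. *)
Lemma romanovski_deriv m :
  (forall j, (j <= m)%N -> 2 * N + 1 - 2 * j%:R != 0) ->
  ('X^2 + b%:P) * (romanovski m)^`() =
    m%:R *: ('X * romanovski m)
    + (2 * N + 1 - 2 * m%:R) *: ('X * romanovski m - romanovski m.+1)
  /\ ('X^2 + b%:P) * (romanovski m.+1)^`() =
    m.+1%:R *: ('X * romanovski m.+1) + romanovski_lower m.+1 *: romanovski m.
Proof.
elim: m => [|m IH] hN.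
  rewrite derivC mulr0 scale0r mulr1 subrr scaler0 addr0; split=> //.
  rewrite derivX mulr1 expr2 scale1r; congr (_ + _).
  rewrite -mul_polyC mulr1; congr (_%:P); rewrite /romanovski_lower /romanovski_ratio; field.
  by apply: (neq0_eq (hN 0%N isT)); ring.
have [IH1 IH0] := IH (fun j lejm => hN j (leqW lejm)).
have [h0 h1] := (hN m (leqnSn m), hN m.+1 (leqnn _)).
split.
  rewrite IH0; congr (_ + _); rewrite romanovskiSS opprD addNKr opprK scalerA.
  by congr (_ *: _); rewrite /romanovski_rec mulrC divfK.
rewrite romanovskiSS derivB derivM derivZ derivX.
rewrite -!mul_polyC in IH0 IH1 *.
have -> : ('X^2 + b%:P) * (1 * romanovski m.+1 + 'X * (romanovski m.+1)^`()
     - (romanovski_rec m.+1)%:P * (romanovski m)^`()) =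
   ('X^2 + b%:P) * romanovski m.+1 + 'X * (('X^2 + b%:P) * (romanovski m.+1)^`())
     - (romanovski_rec m.+1)%:P * (('X^2 + b%:P) * (romanovski m)^`()) by ring.
rewrite IH0 IH1.
have e1 : romanovski_lower m.+1 = romanovski_rec m.+1 * (2 * N + 1 - 2 * m.+1%:R).
  by rewrite /romanovski_rec divfK.
have e2 : romanovski_lower m.+2 = b + romanovski_rec m.+1 * (2 * N + 1 - 2 * m%:R).
  rewrite /romanovski_rec /romanovski_lower /romanovski_ratio; field.
  by apply/andP; split; [apply: (neq0_eq h1)|apply: (neq0_eq h0)]; ring.
rewrite e1 e2 !(rmorphD, rmorphB, rmorphM, rmorph1, rmorph_nat) /=.
ring.
Qed.

(** Differentiate the second formula of [romanovski_deriv], multiply by X^2 + b and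
eliminate H_(m-1)' by the first one: the result is X^2 + b times the equation. *)
Lemma romanovski_ode m :
  (forall j, (j < m)%N -> 2 * N + 1 - 2 * j%:R != 0) ->
  romanovski_op b N m (romanovski m) = 0.
Proof.
case: m => [|m] hN.
  by rewrite /romanovski_op !derivC !(mulr0, scaler0, subr0, mul0r, scale0r).
have [] := romanovski_deriv hN.
set H := romanovski m.+1; set G := romanovski m => B A.
have h0 := hN m (leqnn _).
have S0 : 'X^2 + b%:P != 0 :> {poly F}.
  by rewrite -size_poly_eq0 size_XnaddC.
have := congr1 deriv A.
rewrite !(derivM, derivD, derivZ, derivXn, derivC, derivX) /= => A'.
apply: (mulfI S0); rewrite mulr0 /romanovski_op.
have de : romanovski_lower m.+1 * (2 * N + 1 - 2 * m%:R) = b * m.+1%:R * (2 * N + 1 - m%:R).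
  rewrite /romanovski_lower /romanovski_ratio; field.
  by apply: (neq0_eq h0); ring.
move: A A' B de; rewrite -!mul_polyC => A A' B de.
have {A'}-> : ('X^2 + b%:P) * H^`()^`() =
    m.+1%:R%:P * H + (m.+1%:R%:P - 2%:P) * ('X * H^`()) + (romanovski_lower m.+1)%:P * G^`().
  transitivity (('X *+ 2 + 0) * H^`() + ('X^2 + b%:P) * H^`()^`()
    - 'X *+ 2 * H^`()); first by ring.
  by rewrite A'; ring.
rewrite !mulrBr !mulrDr.
have dG : ('X^2 + b%:P) * ((romanovski_lower m.+1)%:P * G^`()) =
   (romanovski_lower m.+1 * (2 * N + 1 - m%:R))%:P * ('X * G)
   - (b * m.+1%:R * (2 * N + 1 - m%:R))%:P * H.
  by rewrite mulrCA B -de !(rmorphD, rmorphB, rmorphM, rmorph1, rmorph_nat) /=; ring.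
have SH c : ('X^2 + b%:P) * (c * ('X * H^`())) =
   c * ('X * (m.+1%:R%:P * ('X * H) + (romanovski_lower m.+1)%:P * G)).
  by rewrite -A; ring.
rewrite dG !SH !(rmorphD, rmorphB, rmorphM, rmorph1, rmorph_nat) /=.
ring.
Qed.

(** At a root c of X^2 + b the left-hand side of the differentiation formula
vanishes, which leaves a two-term recurrence for the values H_m(c). *)
Lemma romanovski_at_root c m : c ^+ 2 = - b -> c != 0 ->
  (forall j, (j < m)%N -> 2 * N + 1 - 2 * j%:R != 0) ->
  (romanovski m).[c] = c ^+ m *
     \prod_(1 <= j < m.+1) romanovski_ratio j.
Proof.
move=> c2 c0; elim: m => [|m IH] hN.
  by rewrite big_nil hornerC mulr1.
have := congr1 (horner^~ c) (romanovski_deriv hN).2; rewrite !hornerE c2 addNr mul0r.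
rewrite IH; last by move=> j jm; apply: hN; lia.
move=> /esym/eqP; rewrite addr_eq0 => /eqP h.
have m0 : m.+1%:R * c != 0 by rewrite mulf_neq0 // pnatr_eq0.
apply: (mulfI m0); rewrite mulrA -mulrA h [in RHS]big_nat_recr //= /romanovski_lower.
rewrite exprS (_ : b = - c ^+ 2); last by rewrite c2 opprK.
ring.
Qed.

(** Schur's method. The product of H_(m-1) over the roots of H_m is, up to sign, the
product of H_m over the roots of H_(m-1), where the recurrence reduces H_m to
- g_(m-1) H_(m-2). The sign (-1)^(m (m-1)) is 1. *)
Lemma romanovski_resultant (r : nat -> seq F) n :
  (forall m, (m <= n)%N -> romanovski m = \prod_(z <- r m) ('X - z%:P)) ->
  forall m, (m < n)%N ->
  \prod_(z <- r m.+1) (romanovski m).[z] = \prod_(1 <= j < m.+1) (- romanovski_rec j) ^+ j.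
Proof.
move=> hr; elim=> [|m IH] ltmn.
  by rewrite big_nil big1 // => z _; rewrite hornerC.
have szr k : (k <= n)%N -> size (r k) = k.
  move=> lekn; have := (romanovski_monic_size k).2.
  by rewrite hr // size_prod_XsubC => -[].
rewrite big_nat_recr // -IH; last by lia.
rewrite (hr _ (ltnW ltmn)).
under eq_bigr do rewrite horner_prod; rewrite exchange_big.
have e (y : F) : y \in r m.+1 ->
  \prod_(z <- r m.+2) ('X - y%:P).[z] =
    (-1) ^+ m.+2 * (- romanovski_rec m.+1) * (romanovski m).[y].
  move=> yr; have y0 : (romanovski m.+1).[y] = 0.
    by apply/rootP; rewrite (hr _ (ltnW ltmn)) root_prod_XsubC.
  rewrite -mulrA; have <- : (romanovski m.+2).[y] = - romanovski_rec m.+1 * (romanovski m).[y].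
    by rewrite romanovskiSS !hornerE y0; ring.
  rewrite (hr _ ltmn) horner_prod -[X in _ ^+ X](szr m.+2) //.
  elim: (r m.+2) => [|z s IHs]; first by rewrite !big_nil mul1r.
  by rewrite !big_cons exprS IHs !hornerXsubC; ring.
rewrite (eq_big_seq _ e) big_split /= mulrC; congr (_ * _).
rewrite big_const_seq count_predT szr; last by lia.
rewrite iter_mulr_1 exprMn -exprM (_ : (-1) ^+ _ = 1) ?mul1r //.
by rewrite -signr_odd oddM /= negbK andbN.
Qed.
Arguments romanovski : simpl never.
End Rec.
Arguments romanovski : simpl never.

(** * Jacobi polynomials with equal parameters *)

Section Jacobi.
Variable F : numFieldType.
Implicit Types (b N c : F) (n m k : nat).

(** The image of a basis element involves two neighbours only: X^2 - 1 factors as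
(X - 1) (X + 1), and each of these factors acts on its own powers as an Euler
operator. *)
Lemma romanovski_op_jacobi_basis N k m :
  romanovski_op (- 1) N (k + m) (('X - 1) ^+ k * ('X + 1) ^+ m) =
    (2 * k%:R * (k%:R - 1 - N)) *: (('X - 1) ^+ k.-1 * ('X + 1) ^+ m)
    - (2 * m%:R * (m%:R - 1 - N)) *: (('X - 1) ^+ k * ('X + 1) ^+ m.-1).
Proof.
have d1 (q : {poly F}) j : q^`() = 1 ->
  q * (q ^+ j)^`() = j%:R *: q ^+ j /\
  q * (q ^+ j)^`()^`() = (j%:R - 1) *: (q ^+ j)^`().
  move=> q1; have e1 i : q * (q ^+ i)^`() = i%:R *: q ^+ i.
    rewrite deriv_exp q1 mul1r; case: i => [|i]; rewrite ?mulr0n ?mulr0 ?scale0r //=.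
    by rewrite mulrnAr -exprS scaler_nat.
  split=> //; have := congr1 deriv (e1 j).
  by rewrite derivM q1 mul1r derivZ scalerBl scale1r => <-; rewrite addrAC subrr add0r.
have dp : ('X - 1 : {poly F})^`() = 1 by rewrite derivB derivX derivC subr0.
have dq : ('X + 1 : {poly F})^`() = 1 by rewrite derivD derivX derivC addr0.
have [p1 p2] := d1 _ k dp; have [q1 q2] := d1 _ m dq.
have p0 : (('X - 1 : {poly F}) ^+ k)^`() = k%:R *: ('X - 1) ^+ k.-1.
  by rewrite deriv_exp dp mul1r scaler_nat.
have q0 : (('X + 1 : {poly F}) ^+ m)^`() = m%:R *: ('X + 1) ^+ m.-1.
  by rewrite deriv_exp dq mul1r scaler_nat.
have -> : (2 * k%:R * (k%:R - 1 - N)) *: (('X - 1) ^+ k.-1 * ('X + 1) ^+ m)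
   = (2 * (k%:R - 1 - N)) *: ((('X - 1) ^+ k)^`() * ('X + 1) ^+ m).
  by rewrite p0 -scalerAl scalerA mulrAC.
have -> : (2 * m%:R * (m%:R - 1 - N)) *: (('X - 1) ^+ k * ('X + 1) ^+ m.-1)
   = (2 * (m%:R - 1 - N)) *: (('X - 1) ^+ k * (('X + 1) ^+ m)^`()).
  by rewrite q0 -scalerAr scalerA mulrAC.
rewrite /romanovski_op derivM derivD !derivM.
move: p1 p2 q1 q2 {p0 q0 d1 dp dq}.
set P := _ ^+ k; set Q := _ ^+ m; set P' := P^`(); set Q' := Q^`().
rewrite natrD -!mul_polyC !(rmorphN, rmorphD, rmorphB, rmorphM, rmorph1, rmorph_nat) /=.
move: P' Q' (P'^`()) (Q'^`()) => P' Q' P'' Q'' p1 p2 q1 q2.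
have -> : ('X^2 - 1) * (P'' * Q + P' * Q' + (P' * Q' + P * Q'')) =
   (('X - 1) * P'') * (('X - 1) * Q + 2 * Q) + 2 * (('X - 1) * P') * (('X + 1) * Q')
    + (('X + 1) * Q'') * (('X + 1) * P - 2 * P) by ring.
have -> : 'X * (P' * Q + P * Q') =
   ('X - 1) * P' * Q + P' * Q + (P * (('X + 1) * Q') - P * Q') by ring.
rewrite p2 q2 p1 q1.
transitivity (
 (k%:R - 1) * (('X - 1) * P') * Q + 2 * (k%:R - 1) * P' * Q + 2 * (k%:R * P) * (m%:R * Q) +
 (m%:R - 1) * P * (('X + 1) * Q') - 2 * (m%:R - 1) * P * Q' -
 2 * N%:P * (k%:R * P * Q + P' * Q + (P * (m%:R * Q) - P * Q')) -
 (k%:R + m%:R) * (k%:R + m%:R - 1 - 2 * N%:P) * (P * Q)); first by ring.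
rewrite p1 q1; ring.
Qed.

Lemma gbinomS (t : F) j : gbinom t j.+1 * j.+1%:R = gbinom t j * (t - j%:R).
Proof.
rewrite /gbinom big_nat_recr //= factS natrM; field.
by rewrite pnatr_eq0 -lt0n fact_gt0 addrC natr1 pnatr_eq0.
Qed.

(** On the defining sum, the two neighbours produced by [romanovski_op_jacobi_basis]
cancel after a shift of the index, by the recurrence of the binomials. *)
Lemma jacobi_romanovski_op N n : romanovski_op (-1) N n (jacobi n (- N - 1) (- N - 1)) = 0.
Proof.
rewrite /jacobi romanovski_opZ (_ : romanovski_op _ _ _ _ = 0) ?scaler0 //.
set g := gbinom (n%:R + (- N - 1)).
rewrite (big_morph (romanovski_op (-1) N n) (romanovski_opD _ _ _) (romanovski_op0 _ _ _)).
under eq_big_nat => k /andP[_ lekn].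
  have := romanovski_op_jacobi_basis N k (n - k); rewrite (subnKC (lekn : (k <= n)%N)) => e.
  rewrite romanovski_opZ {}e scalerBr !scalerA.
  over.
rewrite /= sumrB big_nat_recl //= !(mulr0, mul0r, scale0r) add0r.
rewrite [X in _ - X]big_nat_recr //= subnn !(mulr0, mul0r, scale0r) addr0.
apply/eqP; rewrite subr_eq0; apply/eqP/eq_big_nat => k /andP[_ ltkn].
rewrite -[(n - k)%N](@subnSK k n) //= subnS /=.
congr (_ *: _).
have g1 := gbinomS (n%:R + (- N - 1)) k.
have g2 := gbinomS (n%:R + (- N - 1)) (n - k.+1).
rewrite -/g in g1 g2.
have nE : n%:R = (n - k.+1)%:R + k.+1%:R :> F by rewrite -natrD subnK.
rewrite -subnS; move: g1 g2 nE; set m := (n - k.+1)%N => g1 g2 nE.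
transitivity (2 * (k.+1%:R - 1 - N) * g m * (g k.+1 * k.+1%:R)); first by ring.
transitivity (2 * (m.+1%:R - 1 - N) * g k * (g m.+1 * m.+1%:R)); last by ring.
by rewrite g1 g2 nE -!natr1; ring.
Qed.

Lemma jacobi_size (al be : F) n : (size (jacobi n al be) <= n.+1)%N.
Proof.
apply: (leq_trans (size_scale_leq _ _)).
rewrite (leq_trans (size_sum _ _ _)) // big_mkord; apply/bigmax_leqP => -[k lek] _ /=.
apply: (leq_trans (size_scale_leq _ _)).
have -> : 'X + 1 = 'X - (-1)%:P :> {poly F} by rewrite rmorphN opprK.
rewrite -[1]/(1%:P) size_mul ?expf_neq0 ?polyXsubC_eq0 //.
by rewrite !size_exp_XsubC; lia.
Qed.

Lemma jacobi_horner1 (al be : F) n :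
  (jacobi n al be).[1] = \prod_(j < n) (al + n%:R - j%:R) / n`!%:R.
Proof.
have h0 : ('X - 1 : {poly F}).[1] = 0 by rewrite !hornerE subrr.
have h2 : ('X + 1 : {poly F}).[1] = 2 by rewrite !hornerE.
rewrite /jacobi hornerZ big_nat_recl // hornerD horner_sum big1_seq => [|k _]; last first.
  by rewrite hornerZ hornerM !horner_exp h0 exprS !(mul0r, mulr0).
rewrite subn0 expr0 mul1r hornerZ horner_exp h2 addr0 /gbinom big_nil divr1 mulr1.
rewrite mulrCA mulVf ?mulr1 ?expf_neq0 ?pnatr_eq0 // big_mkord.
by congr (_ / _); apply: eq_bigr => i _; rewrite [al + _]addrC.
Qed.

(** The substitution x = c t carries the equation with b = - c^2 to the one with
b = -1, so uniqueness makes the two solutions proportional. The factor is expressed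
by the values at t = 1, which avoids the Vandermonde convolution needed for the
leading coefficient of the Jacobi polynomial. *)
Lemma jacobi_proportional N c n (H : {poly F}) :
  c != 0 -> (forall j, (j < n)%N -> 2 * N + 1 - n%:R - j%:R != 0) ->
  (size H <= n.+1)%N -> H`_n = 1 -> romanovski_op (- c ^+ 2) N n H = 0 ->
  forall t, (jacobi n (- N - 1) (- N - 1)).[1] * H.[c * t] =
    H.[c] * (jacobi n (- N - 1) (- N - 1)).[t].
Proof.
move=> c0 hN sH H1 odeH.
set J := jacobi _ _ _.
pose y : {poly F} := \poly_(i < n.+1) (c ^+ i * H`_i).
have yE t : y.[t] = H.[c * t].
  rewrite (horner_coef_wide _ sH) horner_poly; apply: eq_bigr => i _.
  by rewrite exprMn; ring.
have yc i : y`_i = c ^+ i * H`_i.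
  rewrite coef_poly; case: ltnP => // lt.
  by rewrite [H`_i]nth_default ?mulr0 // (leq_trans sH).
have odey : romanovski_op (- 1) N n y = 0.
  apply/polyP => j; rewrite coef0 coef_romanovski_op !yc.
  transitivity (c ^+ j * (romanovski_op (- c ^+ 2) N n H)`_j); last by rewrite odeH coef0 mulr0.
  by rewrite coef_romanovski_op !exprS; ring.
have : J`_n *: y - c ^+ n *: J = 0.
  apply: (@romanovski_op_eq0 _ (- 1) N n _ hN).
  - rewrite (leq_trans (size_polyD _ _)) // size_polyN geq_max.
    by apply/andP; split; apply: (leq_trans (size_scale_leq _ _));
      [exact: size_poly|exact: jacobi_size].
  - rewrite romanovski_opB (romanovski_opZ _ _ _ _ y) (romanovski_opZ _ _ _ _ J).
    by rewrite odey jacobi_romanovski_op !scaler0 subrr.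
  - by rewrite coefB !coefZ yc H1; ring.
move/eqP; rewrite subr_eq0 => /eqP e t.
have et u : J`_n * H.[c * u] = c ^+ n * J.[u].
  by have := congr1 (horner^~ u) e; rewrite !hornerZ yE.
have := et t; have := et 1; rewrite mulr1 => e1 e2.
apply: (mulfI (expf_neq0 n c0)); rewrite !mulrA -e1 mulrAC e2.
ring.
Qed.
End Jacobi.

(** * The explicit coefficients and the product formulas *)

Section FeketePoly.
Variables (R : realType) (a s : R) (n : nat).

Let den (j : nat) : R := 2 * s * (n%:R - 1) - 2 * n%:R + 2 * j%:R + 1.

Let t (k : nat) : R :=
  (-1) ^+ k * a ^+ (2 * k) * 'C(n, 2 * k)%:R *
  ((double_fact (2 * k - 1))%:R / \prod_(1 <= j < k.+1) den j).

(** The leading term is the summand k = 0: there the truncated 2 k - 1 is 0 and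
the double factorial is 1. *)
Lemma fekete_polyE :
  fekete_poly a s n = \sum_(0 <= k < (n./2).+1) t k *: 'X^(n - 2 * k).
Proof.
rewrite big_ltn // /t muln0 subn0 bin0 big_nil !expr0 divr1 !mulr1 scale1r.
by [].
Qed.

Lemma fekete_poly_lead : (fekete_poly a s n)`_n = 1.
Proof.
rewrite /fekete_poly coefD coefXn eqxx coef_sum big1_seq ?addr0 //.
move=> k; rewrite mem_index_iota => /andP[_ /andP[k0 kn]].
rewrite coefZ coefXn (_ : (n == _) = false) ?mulr0 //.
by apply/eqP; lia.
Qed.

Lemma fekete_poly_size : (size (fekete_poly a s n) <= n.+1)%N.
Proof.
rewrite fekete_polyE (leq_trans (size_sum _ _ _)) // big_mkord.
apply/bigmax_leqP => k _; rewrite (leq_trans (size_scale_leq _ _)) // size_polyXn.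
by rewrite ltnS leq_subr.
Qed.

Lemma romanovski_op_Xn (F : numFieldType) (b N : F) m :
  romanovski_op b N n 'X^m = (b * m%:R * (m%:R - 1)) *: 'X^(m - 2)
    + ((n%:R - m%:R) * (2 * N + 1 - n%:R - m%:R)) *: 'X^m.
Proof.
apply/polyP => j; rewrite [RHS]coefD !coefZ coef_romanovski_op !coefXn.
have [->|jm] := eqVneq j m.
  rewrite (_ : (m.+2 == m) = false); last by apply/eqP; lia.
  case: m => [|[|m]]; rewrite ?mulr0 ?mul0r ?subrr ?mulr0 ?mul0r //.
  by rewrite (_ : (_ == _) = false) ?mulr0 ?mul0r //; apply/eqP; lia.
rewrite !mulr0 !addr0; case: m jm => [|[|m]] jm.
- by rewrite (_ : (j.+2 == 0) = false) // !(mulr0, mul0r).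
- by rewrite (_ : (j.+2 == 1) = false) // subrr !(mulr0, mul0r).
rewrite !subSS subn0 !eqSS; have [->|_] := eqVneq j m; rewrite ?mulr0 // !mulr1.
by rewrite -!natr1; ring.
Qed.

Hypothesis den_neq0 : forall j, (0 < j)%N -> den j != 0.

Let t_step k : (2 * k <= n)%N ->
  t k.+1 * (2 * k.+1%:R) * den k.+1 =
    - (a ^+ 2 * (n - 2 * k)%:R * ((n - 2 * k)%:R - 1) * t k).
Proof.
move=> kn; rewrite /t (_ : (2 * k.+1 = (2 * k).+2)%N); last by lia.
have -> : double_fact ((2 * k).+2 - 1) = ((2 * k).+1 * double_fact (2 * k - 1))%N.
  by case: k {kn} => [//|k]; rewrite (_ : (2 * k.+1 = (2 * k).+2)%N) //; lia.
rewrite big_nat_recr //= natrM exprS !exprSr.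
have B : 'C(n, (2 * k).+2)%:R * ((2 * k).+2%:R * (2 * k).+1%:R) =
    (n - 2 * k)%:R * ((n - 2 * k)%:R - 1) * 'C(n, 2 * k)%:R :> R.
  have := mul_bin_left n (2 * k); have := mul_bin_left n (2 * k).+1.
  move=> /(congr1 (fun x => x%:R : R)); rewrite !natrM => b1.
  move=> /(congr1 (fun x => x%:R : R)); rewrite !natrM => b2.
  transitivity ((2 * k).+1%:R * ((2 * k).+2%:R * 'C(n, (2 * k).+2)%:R) : R); first by ring.
  rewrite b1 mulrCA b2.
  have [e|lt] := leqP n (2 * k); first by rewrite (_ : (n - 2 * k = 0)%N) ?mul0r ?mulr0 //; lia.
  have mE : (n - 2 * k)%:R = (n - (2 * k).+1)%:R + 1 :> R by rewrite natr1 subnSK.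
  by rewrite mE; ring.
move: B; rewrite (_ : 2 * k.+1%:R = (2 * k).+2%:R :> R); last by rewrite -natrM; congr (_%:R); lia.
have p0 : \prod_(1 <= j < k.+1) den j != 0.
  rewrite prodf_seq_neq0; apply/allP => j; rewrite mem_index_iota => /andP[j0 _].
  exact: den_neq0.
have := den_neq0 (ltn0Sn k).
move: (den _) (\prod_(_ <= _ < _) _) p0 => d P P0 d0.
move=> B.
transitivity (- ((-1) ^+ k * a ^+ (2 * k) * a ^+ 2 * (double_fact (2 * k - 1))%:R / P) *
  ('C(n, (2 * k).+2)%:R * ((2 * k).+2%:R * (2 * k).+1%:R))).
  by rewrite expr2; field; rewrite P0.
by rewrite B !expr2; field.
Qed.

(** Each monomial has two terms in its image; consecutive monomials of the sum
share a power of X, and the coefficients are such that the sum telescopes. *)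
Lemma fekete_poly_romanovski_op :
  romanovski_op (a ^+ 2) (s * (n%:R - 1)) n (fekete_poly a s n) = 0.
Proof.
rewrite fekete_polyE (big_morph _ (romanovski_opD _ _ _) (romanovski_op0 _ _ _)).
(* U k is minus the share of X^(n - 2 k) in the image of the k-th monomial. *)
pose U k := - ((t k * (2 * k%:R) * den k) *: 'X^(n - 2 * k) : {poly R}).
rewrite (eq_big_nat _ _ (F2 := fun k => U k.+1 - U k)) => [|k /andP[_ lek]].
  rewrite telescope_sumr // /U mulr0 mulr0 mul0r scale0r oppr0 subr0.
(* At the end of the range U vanishes since 'C(n, 2 k) does. *)
  rewrite {1}/t bin_small ?(mulr0, mul0r) ?scale0r ?oppr0 //.
  by have := odd_double_half n; lia.
have kn : (2 * k <= n)%N by have := odd_double_half n; lia.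
rewrite romanovski_opZ romanovski_op_Xn /U t_step //.
have -> : (n - 2 * k.+1 = n - 2 * k - 2)%N by lia.
rewrite scalerDr (scalerA (t k)) (scalerA (t k)) [(- _) *: _]scaleNr !opprK; congr (_ + _).
  by congr (_ *: 'X^_); ring.
by congr (_ *: 'X^_); rewrite natrB // natrM /den; ring.
Qed.
End FeketePoly.

Section Products.
Variable F : numFieldType.
Implicit Types N : F.

(** The Pochhammer symbol (n - 2 N - 1)_n without its sign (-1)^n, that is the
product of 2 N + 1 - j for n <= j < 2 n. *)
Definition desc_prod N n := \prod_(j < n) (2 * N + 1 - n%:R - j%:R).

Lemma desc_prodE N n : desc_prod N n = \prod_(n <= j < 2 * n) (2 * N + 1 - j%:R).
Proof.
rewrite /desc_prod -[X in \prod_(X <= _ < _) _]add0n big_addn mul2n -addnn addnK big_mkord.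
by apply: eq_bigr => j _; rewrite natrD; ring.
Qed.

Lemma desc_prodS N n :
  (2 * N + 1 - n%:R) * desc_prod N n.+1 =
  desc_prod N n * ((2 * N + 1 - 2 * n%:R) * (2 * (N - n%:R))).
Proof.
rewrite !desc_prodE.
transitivity (\prod_(n <= j < 2 * n.+1) (2 * N + 1 - j%:R)).
  by rewrite [RHS]big_ltn //; lia.
rewrite (_ : (2 * n.+1 = (2 * n).+2)%N); last by lia.
rewrite big_nat_recr ?[\big[_/_]_(_ <= _ < (2 * n).+1) _]big_nat_recr /=; try by lia.
by rewrite -mulrA -natr1 natrM; congr (_ * (_ * _)); ring.
Qed.

(** The numerators and [desc_prod] make up the product of 2 N + 1 - j over j < 2 n.
The denominators cancel its factors with j even; those with j = 2 k + 1 are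
2 (N - k). *)
Lemma prod_romanovski_ratio N n :
  (forall j, (j < 2 * n)%N -> 2 * N + 1 - j%:R != 0) ->
  \prod_(1 <= j < n.+1) romanovski_ratio N j * desc_prod N n =
  2 ^+ n * \prod_(j < n) (N - j%:R).
Proof.
elim: n => [|n IH] hN; first by rewrite /desc_prod big_nil !big_ord0 mulr1.
rewrite big_nat_recr // [in RHS]big_ord_recr /= exprS.
have h1 : 2 * N + 1 - n%:R != 0 by apply: hN; lia.
have h2 : 2 * N + 1 - 2 * n%:R != 0 by rewrite -natrM; apply: hN; lia.
have {IH} IH := IH (fun j h => hN j ltac:(lia)).
apply: (mulfI h1); rewrite mulrCA desc_prodS mulrACA IH /romanovski_ratio.
field.
by apply: (neq0_eq h2); ring.
Qed.

End Products.

(** * Products over the roots *)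

Section Values.
Lemma map_romanovski_ratio (F F' : numFieldType) (f : {rmorphism F -> F'}) N j :
  f (romanovski_ratio N j) = romanovski_ratio (f N) j.
Proof.
by rewrite /romanovski_ratio fmorph_div !(rmorphB, rmorph_nat, rmorph1, rmorphD, rmorphM).
Qed.

Lemma map_romanovski_rec (F F' : numFieldType) (f : {rmorphism F -> F'}) b N j :
  f (romanovski_rec b N j) = romanovski_rec (f b) (f N) j.
Proof.
rewrite /romanovski_rec /romanovski_lower -map_romanovski_ratio; move: (romanovski_ratio N j) => q.
by rewrite fmorph_div !(rmorphB, rmorph_nat, rmorph1, rmorphD, rmorphM).
Qed.

Lemma map_romanovski (F F' : numFieldType) (f : {rmorphism F -> F'}) b N m :
  map_poly f (romanovski b N m) = romanovski (f b) (f N) m.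
Proof.
have [] : map_poly f (romanovski b N m) = romanovski (f b) (f N) m /\
  map_poly f (romanovski b N m.+1) = romanovski (f b) (f N) m.+1; last by [].
elim: m => [|m [IH0 IH1]]; first by rewrite /= rmorph1 map_polyX.
by split=> //; rewrite !romanovskiSS rmorphB rmorphM /= map_polyX IH1 map_polyZ IH0 map_romanovski_rec.
Qed.

Variables (R : realType) (a N : R) (n : nat).
Hypothesis a0 : a != 0.
Hypothesis hN : n%:R - 1 < N.

Lemma desc_factor_gt0 j : (j < 2 * n)%N -> 0 < 2 * N + 1 - j%:R.
Proof.
move=> jn; have : j%:R + 1 <= 2 * n%:R :> R by rewrite natr1 -natrM ler_nat.
by move: hN => hN'; lra.
Qed.

Local Open Scope complex_scope.

(** The weight product comes from H_n(i a) H_n(- i a), as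
(i a - x) (- i a - x) = x^2 + a^2; the other one from the differentiation formula
and Schur's method. Both pass through the complex numbers, where all the
polynomials H_m split. *)
Lemma romanovski_root_products (x : 'I_n -> R) :
   \prod_(j < n) ('X - (x j)%:P) = romanovski (a ^+ 2) N n ->
   \prod_(j < n) (x j ^+ 2 + a ^+ 2) = (a ^+ n * \prod_(1 <= j < n.+1) romanovski_ratio N j) ^+ 2
 /\ \prod_(j < n) ((romanovski (a ^+ 2) N n)^`().[x j] * (x j ^+ 2 + a ^+ 2)) =
    romanovski_lower (a ^+ 2) N n ^+ n * \prod_(1 <= j < n) (- romanovski_rec (a ^+ 2) N j) ^+ j.
Proof.
move=> xE.
have h2 j : (j < n)%N -> 2 * N + 1 - 2 * j%:R != 0.
  by move=> jn; rewrite -natrM lt0r_neq0 // desc_factor_gt0 //; lia.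
pose f : {rmorphism R -> R[i]} := real_complex R.
have h2C j : (j < n)%N -> 2 * f N + 1 - 2 * j%:R != 0.
  move=> jn; have := h2 j jn; rewrite -(fmorph_eq0 f).
  by rewrite !(rmorphB, rmorph_nat, rmorph1, rmorphD, rmorphM).
have xEC : \prod_(j < n) ('X - (f (x j))%:P) = romanovski (f (a ^+ 2)) (f N) n.
  rewrite -map_romanovski -xE rmorph_prod /=; apply: eq_bigr => j _.
  by rewrite rmorphB /= map_polyX map_polyC.
have fqE : f (\prod_(1 <= j < n.+1) romanovski_ratio N j) = \prod_(1 <= j < n.+1) romanovski_ratio (f N) j.
  by rewrite rmorph_prod; apply: eq_bigr => j _; rewrite -map_romanovski_ratio.
split.
  apply: (fmorph_inj f).
  have i2 : (f a * 'i%C) ^+ 2 = - f (a ^+ 2).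
    by rewrite exprMn sqr_i mulrN1 rmorphXn.
  have i0 : f a * 'i%C != 0.
    by rewrite -sqrf_eq0 i2 oppr_eq0 fmorph_eq0 expf_neq0.
  have i0' : - (f a * 'i%C) != 0 by rewrite oppr_eq0.
  have e1 := romanovski_at_root i2 i0 h2C.
  have e2 := romanovski_at_root (etrans (sqrrN _) i2) i0' h2C.
  have := congr2 *%R e1 e2; rewrite -xEC !horner_prod -big_split /=.
  under eq_bigr do rewrite !hornerXsubC.
  rewrite -fqE => e; rewrite rmorph_prod.
  transitivity (\prod_(i < n) ((f a * 'i%C - f (x i)) * (- (f a * 'i%C) - f (x i)))).
    apply: eq_bigr => i _; transitivity (f (x i) ^+ 2 - (f a * 'i%C) ^+ 2); last by ring.
    by rewrite i2 opprK rmorphD !rmorphXn.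
  rewrite e rmorphXn rmorphM rmorphXn /=.
  rewrite mulrACA -exprMn mulrN -expr2 i2 opprK -expr2 exprMn -exprM mulnC exprM.
  by rewrite rmorphXn.
have [n0|n_gt0] := posnP n.
  by move: x {xE xEC h2 h2C}; rewrite n0 => x; rewrite !big_ord0 big_nil mulr1 expr0.
have nE : n = n.-1.+1 by rewrite prednK.
have [_] := @romanovski_deriv R (a ^+ 2) N n.-1 (fun j h => h2 j ltac:(lia)).
rewrite -nE => A.
transitivity (\prod_(j < n) (romanovski_lower (a ^+ 2) N n * (romanovski (a ^+ 2) N n.-1).[x j])).
  apply: eq_bigr => j _; have := congr1 (horner^~ (x j)) A.
  have : (romanovski (a ^+ 2) N n).[x j] = 0.
    by rewrite -xE horner_prod (bigD1 j) //= hornerXsubC subrr mul0r.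
  move: (romanovski _ _ _) (romanovski _ _ _) => p q p0.
  by rewrite !(hornerM, hornerD, hornerZ, hornerX, hornerXn, hornerC) p0 !mulr0 add0r => e;
    rewrite mulrC.
rewrite big_split /= prodr_const card_ord; congr (_ * _).
apply: (fmorph_inj f).
(* For m = n the given real roots must be used; below n any splitting will do. *)
pose r m : seq R[i] := if m == n then [seq f (x j) | j <- enum 'I_n]
  else sval (closed_field_poly_normal (romanovski (f (a ^+ 2)) (f N) m)).
have hr m : (m <= n)%N -> romanovski (f (a ^+ 2)) (f N) m = \prod_(z <- r m) ('X - z%:P).
  move=> _; rewrite /r; case: eqVneq => [->|_].
    by rewrite big_map big_enum.
  case: closed_field_poly_normal => /= s {1}->.
  by have [/monicP-> _] := romanovski_monic_size (f (a ^+ 2)) (f N) m; rewrite scale1r.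
have := romanovski_resultant hr (m := n.-1); rewrite -nE => /(_ (ltac:(lia))).
rewrite {1}/r eqxx big_map big_enum /= => e.
rewrite !rmorph_prod /= -[RHS]/(\prod_(1 <= j < n) f ((- romanovski_rec (a ^+ 2) N j) ^+ j)).
transitivity (\prod_(i < n) (romanovski (f (a ^+ 2)) (f N) n.-1).[f (x i)]).
  by apply: eq_bigr => i _; rewrite -map_romanovski horner_map.
rewrite e; apply: eq_bigr => j _.
by rewrite -map_romanovski_rec -(rmorphN f) -(rmorphXn f).
Qed.
End Values.

(** * The discriminant in closed form *)

Section Identity.
Variables (F : numFieldType) (a N : F).

(** For N > n - 1, the part of the diameter formed by |n + k - 2 N - 2|^(n - k). *)
Definition disc_tail n : F := \prod_(1 <= k < n.+1) (2 * N + 2 - n%:R - k%:R) ^+ (n - k).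

Lemma disc_tailE n : disc_tail n = \prod_(n <= j < 2 * n) (2 * N + 1 - j%:R) ^+ (2 * n - j.+1).
Proof.
rewrite /disc_tail big_add1 /= -[X in _ = \prod_(X <= _ < _) _]add0n big_addn.
rewrite (_ : 2 * n - n = n)%N; last by lia.
apply: eq_bigr => j _; congr (_ ^+ _); last by lia.
by rewrite -natr1 natrD; ring.
Qed.

Lemma disc_tailS n :
  (2 * N + 1 - n%:R) ^+ n.+1 * disc_tail n.+1 =
  disc_tail n * desc_prod N n ^+ 2 * (2 * N + 1 - 2 * n%:R).
Proof.
rewrite !disc_tailE desc_prodE.
transitivity (\prod_(n <= j < 2 * n.+1) (2 * N + 1 - j%:R) ^+ (2 * n.+1 - j.+1)).
  rewrite [RHS]big_ltn; last by lia.
  by congr (_ ^+ _ * _); lia.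
rewrite (_ : (2 * n.+1 = (2 * n).+2)%N); last by lia.
rewrite big_nat_recr ?[\big[_/_]_(_ <= _ < (2 * n).+1) _]big_nat_recr /=; try by lia.
rewrite -prodrXl -big_split /= subnn expr0 mulr1 subSnn expr1 natrM; congr (_ * _).
apply: eq_big_nat => j /andP[_ jn].
by rewrite -exprD; congr (_ ^+ _); lia.
Qed.

(** Induction on n with N fixed. All the factors that depend on n are shifted
products of 2 N + 1 - j, so [desc_prodS] and [disc_tailS] reduce the step to an
identity in a, N and n. *)
Lemma disc_identity n :
  (forall j, (j < 2 * n.+1)%N -> 2 * N + 1 - j%:R != 0) ->
  romanovski_lower (a ^+ 2) N n.+1 ^+ n.+1 * \prod_(1 <= j < n.+1) romanovski_rec (a ^+ 2) N j ^+ j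
   * desc_prod N n.+1 ^+ (2 * n) =
  (a ^+ n.+1 * \prod_(1 <= j < n.+2) romanovski_ratio N j) ^+ 2 * (2 * a) ^+ (n.+1 * n) *
  (\prod_(1 <= k < n.+2) k%:R ^+ k *
   \prod_(1 <= k < n.+2) (N + 1 - k%:R) ^+ (2 * k - 2) * disc_tail n.+1).
Proof.
elim: n => [|n IH] hN.
  rewrite !big_nil /disc_tail !big_nat1 muln0 !expr0 !mulr1 /romanovski_lower.
  have -> : romanovski_ratio N 1 = 1.
    rewrite /romanovski_ratio (_ : 2 * N + 2 - 1 = 2 * N + 3 - 2 * 1) ?divff //; last by ring.
    by apply: (neq0_eq (hN 0%N isT)); ring.
  by rewrite !expr1 !mulr1.
have h1 : 2 * N + 1 - n.+1%:R != 0 by apply: hN; lia.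
have h2 : 2 * N + 1 - 2 * n.+1%:R != 0 by rewrite -natrM; apply: hN; lia.
have {IH} := IH (fun j h => hN j ltac:(lia)).
have P := desc_prodS N n.+1; have T := disc_tailS n.+1.
rewrite !(@big_nat_recr _ _ _ n.+2) //=.
rewrite !(@big_nat_recr _ _ _ n.+1 1 (fun j => romanovski_rec _ _ _ ^+ _)) //=.
have gE : romanovski_rec (a ^+ 2) N n.+1 = romanovski_lower (a ^+ 2) N n.+1 / (2 * N + 1 - 2 * n.+1%:R) by [].
have qE : romanovski_ratio N n.+2 = (2 * N + 1 - n.+1%:R) / (2 * N + 1 - 2 * n.+1%:R).
  by rewrite /romanovski_ratio -(natr1 n.+1); congr (_ / _); ring.
have dE : romanovski_lower (a ^+ 2) N n.+2 = a ^+ 2 * n.+2%:R * romanovski_ratio N n.+2 by [].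
have kE : N + 1 - n.+2%:R = N - n.+1%:R by rewrite -(natr1 n.+1); ring.
rewrite dE gE qE kE.
move: (\prod_(1 <= i < n.+1) _) (\prod_(1 <= i < n.+2) _) (\prod_(1 <= i < n.+2) _) (\prod_(1 <= i < n.+2) _).
move=> Gam Q A B.
have -> : desc_prod N n.+2 =
    desc_prod N n.+1 * ((2 * N + 1 - 2 * n.+1%:R) * (2 * (N - n.+1%:R))) / (2 * N + 1 - n.+1%:R).
  by apply: (mulfI h1); rewrite P [RHS]mulrC divfK.
have -> : disc_tail n.+2 =
    disc_tail n.+1 * desc_prod N n.+1 ^+ 2 * (2 * N + 1 - 2 * n.+1%:R) /
    (2 * N + 1 - n.+1%:R) ^+ n.+2.
  apply: (mulfI (expf_neq0 n.+2 h1)); rewrite T [RHS]mulrC divfK // expf_neq0 //.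
move: (romanovski_lower _ _ n.+1) (desc_prod _ _) (disc_tail _) => d D t.
move: h1 h2; move: (2 * N + 1 - n.+1%:R) (2 * N + 1 - 2 * n.+1%:R) (N - n.+1%:R) => v u w h1 h2.
rewrite (_ : (2 * n.+2 - 2 = 2 * n.+1)%N); last by lia.
rewrite (_ : (n.+2 * n.+1 = n.+1 * n + 2 * n.+1)%N); last by lia.
rewrite exprD; move=> E; set c : F := n.+2%:R.
have X2 (x : F) : x ^+ (2 * n.+1) = (x ^+ n.+1) ^+ 2 by rewrite -exprM mulnC.
have DE : D ^+ (2 * n.+1) = D ^+ (2 * n) * D ^+ 2 by rewrite -exprD; congr (_ ^+ _); lia.
transitivity ((d ^+ n.+1 * Gam * D ^+ (2 * n)) *
   ((a ^+ 2 * c * (v / u)) ^+ n.+2 / u ^+ n.+1 * D ^+ 2 * ((u * (2 * w) / v) ^+ n.+1) ^+ 2)).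
  rewrite -X2 (_ : D * (u * (2 * w)) / v = D * (u * (2 * w) / v)); last by ring.
  by rewrite (exprMn _ D) DE expr_div_n; ring.
rewrite E.
have -> : (a ^+ 2 * c * (v / u)) ^+ n.+2 / u ^+ n.+1 * D ^+ 2 * ((u * (2 * w) / v) ^+ n.+1) ^+ 2 =
   a ^+ 2 * (v / u) ^+ 2 * ((2 * a) ^+ n.+1) ^+ 2 * c ^+ n.+2 * (w ^+ n.+1) ^+ 2 * D ^+ 2 * u / v ^+ n.+2.
  rewrite !(exprSr _ n.+1) !expr_div_n !(exprMn, expr_div_n, exprVn).
  have [] := (expf_neq0 n.+1 h1, expf_neq0 n.+1 h2).
  move: (v ^+ _) (u ^+ _) (a ^+ _) (w ^+ _) (c ^+ _) (2 ^+ _) => V U a' w' c' b' V0 U0.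
  by field; rewrite h1 h2 V0 U0.
rewrite !X2 (exprSr a n.+1); ring.
Qed.
End Identity.

(** * The squared energy and its critical points *)

(** Turns the product over pairs j < k of the energy into a product over ordered
pairs, in which the contribution of a single point can be isolated. *)
Lemma prod_pairs (R : comPzRingType) n (f : 'I_n -> 'I_n -> R) :
  \prod_(j < n) \prod_(k < n | (j < k)%N) (f j k * f k j) =
  \prod_(j < n) \prod_(k < n | k != j) f j k.
Proof.
under eq_bigr do rewrite big_split /=.
rewrite big_split /= [X in _ * X](exchange_big_dep predT) //= -big_split /=.
apply: eq_bigr => j _; rewrite [RHS](bigID (fun k : 'I_n => (j < k)%N)) /=.
congr (_ * _); apply: eq_bigl => k; rewrite -val_eqE /=; case: ltngtP => //.
Qed.

Lemma powR_prod (R : realType) (I : Type) (r : seq I) (P : pred I) (F : I -> R) c :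
  (forall i, P i -> 0 <= F i) ->
  (\prod_(i <- r | P i) F i) `^ c = \prod_(i <- r | P i) F i `^ c.
Proof.
move=> F0; suff [] : 0 <= \prod_(i <- r | P i) F i /\
  (\prod_(i <- r | P i) F i) `^ c = \prod_(i <- r | P i) F i `^ c by [].
elim/big_rec2: _ => [|i A B Pi [B0 <-]]; first by rewrite powR1.
by rewrite mulr_ge0 ?F0 // powRM ?F0.
Qed.

Section Analysis.
Import numFieldNormedType.Exports.
Local Open Scope classical_set_scope.
Variables (R : realType) (a s : R).
Hypotheses (a0 : 0 < a) (s1 : 1 < s).

Definition cauchy_wt (c x : R) : R := (x ^+ 2 + a ^+ 2) `^ c.

Lemma quad_gt0 x : 0 < x ^+ 2 + a ^+ 2.
Proof. by rewrite ltr_wpDl ?sqr_ge0 ?exprn_gt0. Qed.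

Lemma cauchy_wt_gt0 c x : 0 < cauchy_wt c x.
Proof. exact/powR_gt0/quad_gt0. Qed.

Lemma cauchy_wtS c x : cauchy_wt (c - 1) x * (x ^+ 2 + a ^+ 2) = cauchy_wt c x.
Proof.
rewrite /cauchy_wt -[X in _ * X]powRr1 ?ltW ?quad_gt0 // -powRD ?subrK //.
by apply/implyP => _; rewrite gt_eqF ?quad_gt0.
Qed.

Lemma is_derive_cauchy_wt c x :
  is_derive x (1 : R) (cauchy_wt c) (c * cauchy_wt (c - 1) x * (2 * x)).
Proof.
pose q : {poly R} := 'X^2 + (a ^+ 2)%:P.
have qE y : q.[y] = y ^+ 2 + a ^+ 2 by rewrite !hornerE.
have D2 := is_derive_poly q x.
have q0 : 0 < q.[x] by rewrite qE quad_gt0.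
have D1 := is_derive1_powR c q0.
have := is_derive1_comp D1 D2.
have -> : (fun y : R => y `^ c) \o horner q = cauchy_wt c.
  by apply/funext => y /=; rewrite qE.
by rewrite derivD derivXn derivC addr0 qE -scaler_nat !hornerE.
Qed.

Lemma continuous_cauchy_wt c : continuous (cauchy_wt c).
Proof.
move=> x; apply: differentiable_continuous; apply/derivable1_diffP.
by case: (is_derive_cauchy_wt c x).
Qed.

Variable n : nat.
Implicit Types x y : 'I_n -> R.

(** The square of the product inside the n-th diameter: squaring makes it a
product over ordered pairs and removes the absolute value from the dependence on a
single point. *)
Definition sq_energy x : R :=
  \prod_(j < n) \prod_(k < n | k != j) (`|x j - x k| * cauchy_wt (- s) (x j)).

Lemma sq_energy_ge0 x : 0 <= sq_energy x.
Proof.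
apply: prodr_ge0 => j _; apply: prodr_ge0 => k _.
by rewrite mulr_ge0 // ltW // cauchy_wt_gt0.
Qed.

Lemma sq_energy_gt0 x : (0 < sq_energy x) <-> injective x.
Proof.
split=> [p j k xjk|xI].
  apply/eqP/negPn/negP => jk; move: p; rewrite /sq_energy (bigD1 j) //=.
  by rewrite (bigD1 k) 1?eq_sym //= xjk subrr normr0 !mul0r ltxx.
apply: prodr_gt0 => j _; apply: prodr_gt0 => k kj.
rewrite mulr_gt0 ?cauchy_wt_gt0 // normr_gt0 subr_eq0.
by apply: contraNneq kj => /xI ->.
Qed.

Lemma sq_energy_prod x : sq_energy x =
  (\prod_(j < n) \prod_(k < n | k != j) `|x j - x k|) *
  (\prod_(j < n) (x j ^+ 2 + a ^+ 2)) `^ (- (s * (n%:R - 1))).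
Proof.
rewrite /sq_energy; under eq_bigr do rewrite big_split /=.
rewrite big_split /=; congr (_ * _).
rewrite powR_prod => [|j _]; last exact/ltW/quad_gt0.
apply: eq_bigr => j _; rewrite prodr_const cardC1 card_ord.
rewrite -powR_mulrn ?powR_ge0 // -powRrM -subn1 natrB ?mulNr //.
by case: n j {x} => [[]|].
Qed.

Definition replace_at x i t : 'I_n -> R := fun j => if j == i then t else x j.

(** As a function of its i-th point t alone the energy is, up to a constant factor,
p(t)^2 (t^2 + a^2)^(-N), which is differentiable everywhere. *)
Lemma sq_energy_replace_at x i : exists2 C, (injective x -> 0 < C) & forall t,
  sq_energy (replace_at x i t) =
  (\prod_(k < n | k != i) ('X - (x k)%:P)).[t] ^+ 2 * cauchy_wt (- (s * (n%:R - 1))) t * C.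
Proof.
exists (\prod_(j < n | j != i) (cauchy_wt (- s) (x j) *
   \prod_(k < n | (k != j) && (k != i)) (`|x j - x k| * cauchy_wt (- s) (x j)))).
  move=> xI; apply: prodr_gt0 => j _; rewrite mulr_gt0 ?cauchy_wt_gt0 //.
  apply: prodr_gt0 => k /andP[kj _]; rewrite mulr_gt0 ?cauchy_wt_gt0 // normr_gt0 subr_eq0.
  by apply: contraNneq kj => /xI ->.
move=> t; rewrite /sq_energy (bigD1 i) //=.
have -> : \prod_(k < n | k != i) (`|replace_at x i t i - replace_at x i t k| * cauchy_wt (- s) (replace_at x i t i))
   = (\prod_(k < n | k != i) `|t - x k|) * cauchy_wt (- (s * (n%:R - 1))) t.
  rewrite big_split /=; congr (_ * _).
    by apply: eq_bigr => k /negPf ki; rewrite /replace_at eqxx ki.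
  rewrite prodr_const cardC1 card_ord /replace_at eqxx.
  rewrite /cauchy_wt -powR_mulrn ?powR_ge0 // -powRrM -subn1 natrB ?mulNr //.
  by case: n i {x} => [[]|].
have -> : \prod_(j < n | j != i) \prod_(k < n | k != j)
     (`|replace_at x i t j - replace_at x i t k| * cauchy_wt (- s) (replace_at x i t j)) =
   (\prod_(j < n | j != i) `|t - x j|) *
   \prod_(j < n | j != i) (cauchy_wt (- s) (x j) *
     \prod_(k < n | (k != j) && (k != i)) (`|x j - x k| * cauchy_wt (- s) (x j))).
  rewrite -big_split /=; apply: eq_bigr => j ji.
  rewrite (bigD1 i) 1?eq_sym //= /replace_at eqxx (negPf ji) -mulrA distrC; congr (_ * (_ * _)).
  by apply: eq_bigr => k /andP[_ /negPf->].
rewrite horner_prod; under [in RHS]eq_bigr do rewrite hornerXsubC.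
rewrite -[in RHS]real_normK ?num_real // normr_prod; ring.
Qed.

(** The derivative of p^2 (t^2 + a^2)^(-N) vanishes at the maximum x_i; divide it by
the nonzero factor 2 p (t^2 + a^2)^(-N-1). *)
Lemma critical_eq x i : injective x -> (forall y, sq_energy y <= sq_energy x) ->
  let p := \prod_(k < n | k != i) ('X - (x k)%:P) in
  (x i ^+ 2 + a ^+ 2) * p^`().[x i] = s * (n%:R - 1) * x i * p.[x i].
Proof.
move=> xI xmax p; have [C /(_ xI) C0 CE] := sq_energy_replace_at x i.
set N := s * (n%:R - 1) in CE *.
pose g : R -> R := (horner p * horner p) * cauchy_wt (- N).
have replaceK : replace_at x i (x i) = x.
  by apply/funext => j; rewrite /replace_at; case: eqP => // ->.
have gmax t : g t <= g (x i).
  have := xmax (replace_at x i t); rewrite -[X in _ <= sq_energy X]replaceK !CE -/p ler_pM2r //.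
have dg t : is_derive t (1 : R) g _ :=
  is_deriveM (is_deriveM (is_derive_poly p t) (is_derive_poly p t))
    (is_derive_cauchy_wt (- N) t).
have p0 : p.[x i] != 0.
  rewrite horner_prod prodf_seq_neq0; apply/allP => k _; apply/implyP => ki.
  by rewrite hornerXsubC subr_eq0; apply: contraNneq ki => /xI ->.
have /(@derive_val _ _ _ _ _ _ _) d0 : is_derive (x i) (1 : R) g 0.
  apply: (@derive1_at_max _ g (x i - 1) (x i + 1)).
  - lra.
  - by move=> t _; case: (dg t).
  - by rewrite in_itv /=; lra.
  - by move=> t _; exact: gmax.
have := dg (x i) => /(@derive_val _ _ _ _ _ _ _); rewrite d0.
rewrite -(cauchy_wtS (- N)) => /esym/eqP.
have w0 := cauchy_wt_gt0 (- N - 1) (x i).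
move: p0 w0 {gmax dg d0}; rewrite -[(horner p * horner p) (x i)]/(p.[x i] * p.[x i]).
move: (cauchy_wt _ _) => w p0 w0.
set e := (X in X == 0).
have -> : e = 2 * w * p.[x i] *
   ((x i ^+ 2 + a ^+ 2) * p^`().[x i] - N * x i * p.[x i]).
  rewrite /e -![_ *: _]/(_ * _); ring.
rewrite !mulf_eq0 (negPf p0) (gt_eqF w0) pnatr_eq0 /= subr_eq0 => /eqP->.
by [].
Qed.
End Analysis.

(** * Existence of a maximizer *)

Section Existence.
Import numFieldNormedType.Exports.
Local Open Scope classical_set_scope.
Variables (R : realType) (a s : R) (n : nat).
Hypotheses (a0 : 0 < a) (s1 : 1 < s) (n2 : (2 <= n)%N).
Implicit Types x y : 'I_n -> R.

Local Notation E := (sq_energy (n:=n) a s).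
Local Notation wt := (cauchy_wt a).

Let rho (x : R) : R := a^-1 * wt (1 - s) x.

Let rho_gt0 (x : R) : 0 < rho x.
Proof. by rewrite mulr_gt0 ?invr_gt0 ?cauchy_wt_gt0. Qed.

Lemma wt_anti (c x y : R) : 0 < c -> x ^+ 2 <= y ^+ 2 -> wt (- c) y <= wt (- c) x.
Proof.
move=> c0 xy; rewrite /cauchy_wt !powRN lef_pV2 ?posrE ?powR_gt0 ?quad_gt0 //.
by apply: ge0_ler_powR; rewrite ?nnegrE ?lerD2r ?(ltW c0) // ltW ?quad_gt0.
Qed.

Let rho_le (x : R) : rho x <= rho 0.
Proof.
rewrite ler_wpM2l ?invr_ge0 ?(ltW a0) // -(opprB s 1).
by rewrite wt_anti ?subr_gt0 // expr0n sqr_ge0.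
Qed.

(** From (x^2 + a^2) (y^2 + a^2) = (x y + a^2)^2 + a^2 (x - y)^2. *)
Lemma pair_factor_le (x y : R) :
  (`|x - y| * wt (- s) x) * (`|y - x| * wt (- s) y) <= rho x * rho y.
Proof.
have -> : (`|x - y| * wt (- s) x) * (`|y - x| * wt (- s) y) =
   (x - y) ^+ 2 * (wt (- s) x * wt (- s) y).
  by rewrite (distrC y) mulrACA -expr2 real_normK ?num_real.
have wS z : wt (1 - s) z = wt (- s) z * (z ^+ 2 + a ^+ 2).
  by rewrite -(cauchy_wtS a0) (_ : 1 - s - 1 = - s) //; ring.
have -> : rho x * rho y =
   a ^- 2 * ((x ^+ 2 + a ^+ 2) * (y ^+ 2 + a ^+ 2)) * (wt (- s) x * wt (- s) y).
  by rewrite /rho !wS -exprVn; ring.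
rewrite ler_pM2r ?mulr_gt0 ?cauchy_wt_gt0 //.
rewrite -(ler_pM2l (exprn_gt0 2 a0)) mulVKf ?expf_neq0 ?gt_eqF //.
have := sqr_ge0 (x * y + a ^+ 2); lra.
Qed.

(** By [pair_factor_le] the energy is at most the product of the rho (x_j)^(n-1);
keep one factor rho (x_i) and bound the others by rho 0. This is where s > 1
enters. *)
Lemma sq_energy_decay : exists2 K : R, 0 < K & forall x i, E x <= K * wt (1 - s) (x i).
Proof.
pose m := n.-1.
exists (a^-1 * (rho 0 ^+ m.-1 * (rho 0 ^+ m) ^+ m)).
  have r0 := rho_gt0 0.
  by rewrite mulr_gt0 ?invr_gt0 // mulr_gt0 ?exprn_gt0 //.
move=> x i.
have -> : E x = \prod_(j < n) \prod_(k < n | (j < k)%N)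
   ((`|x j - x k| * wt (- s) (x j)) * (`|x k - x j| * wt (- s) (x k))).
  by rewrite (prod_pairs (fun j k => `|x j - x k| * wt (- s) (x j))).
apply: (@le_trans _ _ (\prod_(j < n) \prod_(k < n | (j < k)%N) (rho (x j) * rho (x k)))).
  apply: ler_prod => j _; rewrite prodr_ge0 => [|k _] /=; last first.
    by rewrite !mulr_ge0 // ltW // cauchy_wt_gt0.
  apply: ler_prod => k _; rewrite pair_factor_le andbT.
  by rewrite !mulr_ge0 // ltW // cauchy_wt_gt0.
rewrite (prod_pairs (fun j k => rho (x j))).
under eq_bigr do rewrite prodr_const cardC1 card_ord.
rewrite (bigD1 i) //= -/m.
rewrite (_ : a^-1 * _ * _ = rho (x i) * rho 0 ^+ m.-1 * (rho 0 ^+ m) ^+ m); last first.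
  by rewrite /rho; ring.
have mE : m = m.-1.+1 by rewrite prednK // /m; lia.
have rho_ge0 (t : R) : 0 <= rho t by exact/ltW/rho_gt0.
apply: ler_pM; rewrite ?exprn_ge0 //.
- by apply: prodr_ge0 => j _; rewrite exprn_ge0.
- rewrite {1}mE exprS ler_wpM2l // lerXn2r ?nnegrE //.
- rewrite (_ : (rho 0 ^+ m) ^+ m = \prod_(j < n | j != i) rho 0 ^+ m).
    by apply: ler_prod => j _; rewrite exprn_ge0 //= lerXn2r ?nnegrE.
  by rewrite prodr_const cardC1 card_ord.
Qed.

(** Compare with the points 0, 1, ..., n-1: by [sq_energy_decay] any configuration
that does as well lies in a fixed compact box. *)
Lemma sq_energy_max : exists x, injective x /\ forall y, E y <= E x.
Proof.
have [K K0 decay] := sq_energy_decay.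
(* A test configuration, used only for its positive energy. *)
pose x0 (j : 'I_n) : R := j%:R.
have x0I : injective x0 by move=> j k /eqP; rewrite eqr_nat => /eqP/val_inj.
have Ex0 : 0 < E x0 by rewrite sq_energy_gt0.
(* Chosen so that K X^(1-s) is the energy of x0; L makes L < |t| imply X < t^2. *)
pose X := (E x0 / K) `^ (- (s - 1)^-1).
pose L := 1 + X.
have X0 : 0 < X by rewrite powR_gt0 // divr_gt0.
have far (t : R) : L < `|t| -> K * wt (1 - s) t < E x0.
  move=> Lt; rewrite mulrC -ltr_pdivlMr // /cauchy_wt.
  have Xt : X < t ^+ 2 + a ^+ 2.
    rewrite ltr_wpDr ?sqr_ge0 // -real_normK ?num_real //.
    by move: Lt X0; rewrite /L; nra.
  have -> : E x0 / K = X `^ (1 - s).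
    rewrite /X -powRrM (_ : - (s - 1)^-1 * (1 - s) = 1) ?(powRr1 (ltW (divr_gt0 Ex0 K0))) //.
    by field; rewrite subr_eq0 gt_eqF.
  rewrite -(opprB s 1) !powRN ltf_pV2 ?posrE ?(powR_gt0 _ X0) ?(powR_gt0 _ (quad_gt0 a0 t)) //.
  by apply: gt0_ltr_powR; rewrite ?nnegrE ?subr_gt0 // ltW ?quad_gt0.
pose A := [set v : 'rV[R]_n | forall i, `[- L, L] (v ord0 i)].
have cA : compact A by apply: (@rV_compact _ _ (fun=> `[- L, L])) => i; exact: segment_compact.
pose f (v : 'rV[R]_n) := E (fun i => v ord0 i).
have cf : continuous f.
  have cM : continuous (fun x : R * R => x.1 * x.2).
    by move=> x; apply: cvgM; [exact: cvg_fst|exact: cvg_snd].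
  apply: (continuous_big cM) => j _; apply: (continuous_big cM) => k _ v.
  have cc l : continuous (fun v : 'rV[R]_n => v ord0 l) by exact: coord_continuous.
  have c1 : {for v, continuous (fun v : 'rV[R]_n => `|v ord0 j - v ord0 k|)}.
    apply: (@continuous_comp _ _ _ (fun v : 'rV[R]_n => v ord0 j - v ord0 k) Num.norm).
      exact: continuousB (cc j v) (cc k v).
    exact: norm_continuous.
  have c2 : {for v, continuous (fun v : 'rV[R]_n => wt (- s) (v ord0 j))}.
    apply: (@continuous_comp _ _ _ (fun v : 'rV[R]_n => v ord0 j) (wt (- s)) v (cc j v)).
    exact: continuous_cauchy_wt.
  exact: (continuousM c1 c2).
have inA (y : 'I_n -> R) : E x0 <= E y -> A (\row_i y i).
  move=> Ey i /=; rewrite mxE in_itv /= -ler_norml leNgt; apply/negP => Ly; have := far _ Ly.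
  by rewrite ltNge (le_trans Ey) ?decay.
have fE (y : 'I_n -> R) : f (\row_i y i) = E y.
  by rewrite /f; congr (sq_energy _ _ _); apply/funext => i; rewrite mxE.
have A0 : A !=set0 by exists (\row_i x0 i); apply: inA.
have [v _ vmax] := compact_EVT_max A0 cA (continuous_subspaceT cf).
have vx0 : E x0 <= f v by rewrite -fE; apply: vmax; rewrite inE; exact: inA.
exists (fun i => v ord0 i); split.
  by apply/(sq_energy_gt0 s a0); exact: lt_le_trans Ex0 vx0.
move=> y; have [le|/ltW le] := leP (E x0) (E y).
  by rewrite -fE; apply: vmax; rewrite inE; exact: inA.
exact: le_trans vx0.
Qed.

End Existence.

(** * Fekete sets are root sets *)

Section Assembly.
Variables (R : realType) (a s : R) (n : nat).
Hypotheses (a0 : 0 < a) (s1 : 1 < s) (n2 : (2 <= n)%N).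
Implicit Types x y : 'I_n -> R.
Local Open Scope complex_scope.

Local Notation N := (s * (n%:R - 1)).
Local Notation E := (sq_energy (n:=n) a s).

Lemma N_gt : n%:R - 1 < N.
Proof.
have : 1 <= n%:R - 1 :> R by rewrite lerBrDr -[1 + 1]/(2%:R) ler_nat.
by move=> n1; rewrite ltr_pMl //; lra.
Qed.

Let factor_gt0 j : (j < 2 * n)%N -> 0 < 2 * N + 1 - j%:R.
Proof. exact: (desc_factor_gt0 N_gt). Qed.

Lemma ode_indicial_neq0 j : (j < n)%N -> 2 * N + 1 - n%:R - j%:R != 0.
Proof.
move=> jn; rewrite -addrA -opprD -natrD lt0r_neq0 // factor_gt0 //; lia.
Qed.

Lemma fekete_poly_solution : romanovski_op (a ^+ 2) N n (fekete_poly a s n) = 0.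
Proof.
apply: fekete_poly_romanovski_op => j j0; rewrite lt0r_neq0 //.
have : 1 <= j%:R :> R by rewrite ler1n.
by move: N_gt => + ?; lra.
Qed.

Lemma ode_monic_unique (p : {poly R}) : (size p <= n.+1)%N -> p`_n = 1 ->
  romanovski_op (a ^+ 2) N n p = 0 -> p = fekete_poly a s n.
Proof.
move=> sp pn op; apply/eqP; rewrite -subr_eq0; apply/eqP.
apply: (romanovski_op_eq0 ode_indicial_neq0 (b := a ^+ 2)).
- by rewrite (leq_trans (size_polyD _ _)) // size_polyN geq_max sp fekete_poly_size.
- by rewrite romanovski_opB op fekete_poly_solution subrr.
- by rewrite coefB pn fekete_poly_lead subrr.
Qed.

Lemma fekete_romanovski : fekete_poly a s n = romanovski (a ^+ 2) N n.
Proof.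
have [mo sz] := romanovski_monic_size (a ^+ 2) N n.
apply/esym/ode_monic_unique; rewrite ?sz //.
  by move/monicP: mo; rewrite lead_coefE sz.
by apply: romanovski_ode => j jn; rewrite -natrM lt0r_neq0 // factor_gt0 //; lia.
Qed.

(** Stieltjes' argument: the image of p has degree less than n and vanishes at the n
distinct points, hence is 0. At x_i one has p' = q and p'' = 2 q' with
q = p / (X - x_i). *)
Lemma maximizer_poly x : injective x -> (forall y, E y <= E x) ->
  \prod_(j < n) ('X - (x j)%:P) = fekete_poly a s n.
Proof.
move=> xI xmax; set p := \prod_(j < n) _.
have sp : size p = n.+1 by rewrite /p -big_enum size_prod_XsubC size_enum_ord.
have mp : p`_n = 1.
  by have := monic_prod_XsubC (index_enum 'I_n) predT x => /monicP; rewrite lead_coefE -/p sp.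
apply: ode_monic_unique; rewrite ?sp //.
apply: (@roots_geq_poly_eq0 _ _ [seq x j | j <- enum 'I_n]).
- apply/allP => _ /mapP[i _ ->]; apply/rootP.
  have := critical_eq a0 i xI xmax.
  have pE : p = ('X - (x i)%:P) * \prod_(k < n | k != i) ('X - (x k)%:P) by rewrite /p (bigD1 i).
  rewrite pE; move: (\prod_(k < n | k != i) _) => q /= e.
  rewrite /romanovski_op !(derivM, derivB, derivD, derivX, derivC).
  rewrite !(hornerD, hornerN, hornerM, hornerZ, hornerX, hornerXn, hornerC, hornerXsubC).
  transitivity (2 * ((x i ^+ 2 + a ^+ 2) * q^`().[x i] - N * x i * q.[x i])); first by ring.
  by rewrite e subrr mulr0.
- by rewrite map_inj_uniq // enum_uniq.
- by rewrite size_map size_enum_ord romanovski_op_size ?sp.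
Qed.

Lemma normc_real (r : R) : normc r%:C = `|r|.
Proof. by rewrite /= expr0n addr0 sqrtr_sqr. Qed.

Lemma weighted_energy_real x :
  weighted_energy (n:=n) (fun z : R[i] => normc (z - a%:C * 'i%C) `^ (- s)) (fun j => (x j)%:C) =
  E x `^ (1 / (n%:R * (n%:R - 1))).
Proof.
pose w (t : R) := cauchy_wt a (- s / 2) t.
have wE t : normc (t%:C - a%:C * 'i%C) `^ (- s) = w t.
  rewrite /w /cauchy_wt [- s / 2]mulrC powRrM powR12_sqrt ?ltW ?quad_gt0 //; congr (_ `^ _).
  by rewrite /= !(mulr0, mul0r, mulr1, mul1r, subr0, sub0r, addr0, add0r, sqrrN, oppr0).
have w2 t : w t ^+ 2 = cauchy_wt a (- s) t.
  by rewrite /w /cauchy_wt -powR_mulrn ?powR_ge0 // -powRrM; congr (_ `^ _); field.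
pose B := \prod_(j < n) \prod_(k < n | (j < k)%N) (`|x j - x k| * w (x j) * w (x k)).
transitivity (B `^ (2 / (n%:R * (n%:R - 1)))).
  congr (_ `^ _); apply: eq_bigr => j _; apply: eq_bigr => k _.
  by rewrite -rmorphB normc_real !wE.
have B0 : 0 <= B.
  apply: prodr_ge0 => j _; apply: prodr_ge0 => k _.
  by rewrite !mulr_ge0 // ltW // cauchy_wt_gt0.
have -> : E x = B ^+ 2.
  rewrite /sq_energy -(prod_pairs (fun j k => `|x j - x k| * cauchy_wt a (- s) (x j))) /B -prodrXl.
  apply: eq_bigr => j _; rewrite -prodrXl; apply: eq_bigr => k _.
  by rewrite -!w2 (distrC (x k)); ring.
by rewrite -powR_mulrn // -powRrM mulrA mulr1.
Qed.

Local Notation w := (fun z : R[i] => normc (z - a%:C * 'i%C) `^ (- s)).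

Lemma energy_exp_gt0 : 0 < 1 / (n%:R * (n%:R - 1)) :> R.
Proof.
rewrite divr_gt0 // mulr_gt0 ?ltr0n ?subr_gt0 ?ltr1n //; exact: ltnW.
Qed.

Lemma real_listing (Z : set R[i]) (z : 'I_n -> R[i]) :
  (Z `<=` real_line R)%classic -> npoint_listing Z z ->
  exists2 x, injective x & z = (fun j => (x j)%:C).
Proof.
move=> ZR [zI zZ].
have zE j : z j = (complex.Re (z j))%:C.
  by have [r _ <-] : real_line R (z j) by apply: ZR; rewrite -zZ; exists j.
exists (fun j => complex.Re (z j)); last by apply/funext.
by move=> j k jk; apply: zI; rewrite zE jk -zE.
Qed.

Lemma energy_le_diameter x : injective x ->
  ((E x `^ (1 / (n%:R * (n%:R - 1))))%:E <= weighted_diameter n w (real_line R))%E.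
Proof.
move=> xI; apply: ereal_sup_ubound.
exists (range (fun j => (x j)%:C))%classic, (fun j => (x j)%:C); split.
- by move=> _ [j _ <-]; exists (x j).
- by split=> // j k /complexI; exact: xI.
- by rewrite weighted_energy_real.
Qed.

Lemma diameter_maximizer x : injective x -> (forall y, E y <= E x) ->
  weighted_diameter n w (real_line R) = (E x `^ (1 / (n%:R * (n%:R - 1))))%:E.
Proof.
move=> xI xmax; apply/le_anti; rewrite energy_le_diameter // andbT.
apply: ge_ereal_sup => _ [Z [z [ZR /(real_listing ZR)[y _ ->] ->]]].
rewrite weighted_energy_real lee_fin.
by apply: ge0_ler_powR; rewrite ?nnegrE ?sq_energy_ge0 ?(ltW energy_exp_gt0).
Qed.

(** Configurations with a repeated point are not among the n-point sets, but their
energy is 0, so a Fekete set still maximizes over all configurations. *)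
Lemma fekete_maximizer (F : set R[i]) : weighted_fekete_set n w (real_line R) F ->
  exists x, [/\ injective x, forall y, E y <= E x & F = range (fun j => (x j)%:C)]%classic.
Proof.
move=> [FR [z [zF]]]; have [x xI zE] := real_listing FR zF.
rewrite {}zE in zF *; rewrite weighted_energy_real => xd.
exists x; split=> //; last by case: zF.
move=> y; have [|yn] := boolP (0 < E y); last first.
  by rewrite (le_trans _ (sq_energy_ge0 _ _ x)) // leNgt.
move/sq_energy_gt0 => /(_ a0)/energy_le_diameter; rewrite -xd lee_fin => le.
rewrite leNgt; apply/negP => lt; move: le; rewrite leNgt => /negP; apply.
by apply: gt0_ltr_powR; rewrite ?nnegrE ?sq_energy_ge0 ?energy_exp_gt0.
Qed.

Lemma fekete_roots x : \prod_(j < n) ('X - (x j)%:P) = fekete_poly a s n ->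
  [set z : R[i] | root (map_poly (real_complex R) (fekete_poly a s n)) z]%classic =
  range (fun j => (x j)%:C).
Proof.
move=> <-; rewrite map_prod_XsubC; apply/seteqP; split => [z|_ [j _ <-]] /=.
  rewrite -(big_map (fun j => (x j)%:C) predT (fun c => 'X - c%:P)) root_prod_XsubC.
  by move=> /mapP[j _ ->]; exists j.
by apply/rootP; rewrite horner_prod (bigD1 j) //= hornerXsubC subrr mul0r.
Qed.

(** Existence of a maximizer gives the converse: the root set is the one of that
maximizer. *)
Lemma fekete_set_iff (F : set R[i]) : weighted_fekete_set n w (real_line R) F <->
  F = [set z : R[i] | root (map_poly (real_complex R) (fekete_poly a s n)) z]%classic.
Proof.
split=> [/fekete_maximizer [x [xI xmax ->]]|->].
  by rewrite (fekete_roots (maximizer_poly xI xmax)).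
have [x [xI xmax]] := sq_energy_max a0 s1 n2.
rewrite (fekete_roots (maximizer_poly xI xmax)); split.
  by move=> _ [j _ <-]; exists (x j).
exists (fun j => (x j)%:C); split.
  by split=> // j k /complexI; exact: xI.
by rewrite weighted_energy_real (diameter_maximizer xI xmax).
Qed.

End Assembly.

(** * The Jacobi form and the value of the diameter *)

Section JacobiForm.
Variables (F : numFieldType) (N : F) (n : nat).

Lemma pochhammer_desc :
  pochhammer (n%:R - 2 * N - 1) n = (-1) ^+ n * desc_prod N n.
Proof.
rewrite /pochhammer /desc_prod big_mkord -[in (-1) ^+ _](card_ord n) -prodr_const -big_split /=.
by apply: eq_bigr => j _; ring.
Qed.

Lemma pochhammer_opp : pochhammer (- N) n = (-1) ^+ n * \prod_(j < n) (N - j%:R).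
Proof.
rewrite /pochhammer big_mkord -[in (-1) ^+ _](card_ord n) -prodr_const -big_split /=.
by apply: eq_bigr => j _; ring.
Qed.

Lemma romanovski_jacobi c : c != 0 ->
  (forall j, (j < 2 * n)%N -> 2 * N + 1 - j%:R != 0) ->
  forall t, (romanovski (- c ^+ 2) N n).[c * t] =
    (2 * c) ^+ n * n`!%:R / pochhammer (n%:R - 2 * N - 1) n *
    (jacobi n (- N - 1) (- N - 1)).[t].
Proof.
move=> c0 hN t.
have h2 j : (j < n)%N -> 2 * N + 1 - 2 * j%:R != 0.
  by move=> jn; rewrite -natrM hN //; lia.
have h1 j : (j < n)%N -> 2 * N + 1 - n%:R - j%:R != 0.
  by move=> jn; rewrite -addrA -opprD -natrD hN //; lia.
have [mo sz] := romanovski_monic_size (- c ^+ 2) N n.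
have H1 : (romanovski (- c ^+ 2) N n)`_n = 1 by move/monicP: mo; rewrite lead_coefE sz.
have := jacobi_proportional c0 h1 (eq_leq sz) H1 (romanovski_ode _ h2) t.
rewrite (romanovski_at_root (esym (opprK _)) c0 h2).
have J1 : (jacobi n (- N - 1) (- N - 1)).[1] = (-1) ^+ n * \prod_(j < n) (N - j%:R) / n`!%:R.
  rewrite jacobi_horner1 (reindex_inj rev_ord_inj) /=; congr (_ / _).
  rewrite -[in (-1) ^+ _](card_ord n) -prodr_const -big_split /=.
  by apply: eq_bigr => j _; rewrite natrB // -natr1; ring.
rewrite J1 pochhammer_desc.
have Q := prod_romanovski_ratio hN.
have f0 : n`!%:R != 0 :> F by rewrite pnatr_eq0 -lt0n fact_gt0.
have s0 : (-1) ^+ n != 0 :> F by rewrite signr_eq0.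
have D0 : desc_prod N n != 0.
  by rewrite prodf_seq_neq0; apply/allP => j _ /=; rewrite h1.
have P0 : \prod_(j < n) (N - j%:R) != 0.
  rewrite prodf_seq_neq0; apply/allP => j _ /=.
  have := hN (2 * j).+1 ltac:(have := ltn_ord j; lia).
  apply: contraNneq => e; rewrite -(natr1 (2 * j)) natrM.
  by apply/eqP; transitivity (2 * (N - j%:R)); [ring | rewrite e mulr0].
move: Q; rewrite exprMn.
move: (jacobi _ _ _).[t] (romanovski _ _ _).[_] f0 s0 D0 P0 => J H.
move: (\prod_(1 <= j < n.+1) _) (\prod_(j < n) _) (desc_prod _ _).
move: ((-1) ^+ n) (n`!%:R) (c ^+ n) (2 ^+ n).
move=> e f C T Q P D f0 e0 D0 P0 QE E.
have -> : T = Q * D / P by rewrite QE mulfK.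
apply: (mulfI (_ : e * P / f != 0)); first by rewrite !mulf_neq0 ?invr_eq0.
by rewrite E; field; rewrite f0 e0 D0 P0.
Qed.
End JacobiForm.

Lemma map_pochhammer (F F' : numFieldType) (f : {rmorphism F -> F'}) t n :
  f (pochhammer t n) = pochhammer (f t) n.
Proof.
by rewrite /pochhammer rmorph_prod; apply: eq_bigr => j _; rewrite rmorphD rmorph_nat.
Qed.

Section Value.
Variables (R : realType) (a s : R) (n : nat).
Hypotheses (a0 : 0 < a) (s1 : 1 < s) (n2 : (2 <= n)%N).
Local Notation N := (s * (n%:R - 1)).

Lemma prod_roots_deriv (x : 'I_n -> R) :
  \prod_(j < n) \prod_(k < n | k != j) `|x j - x k| =
  `|\prod_(j < n) (\prod_(k < n) ('X - (x k)%:P))^`().[x j]|.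
Proof.
rewrite normr_prod; apply: eq_bigr => j _; rewrite -normr_prod.
rewrite [in RHS](bigD1 j) //=; set q : {poly R} := \prod_(k < n | k != j) ('X - (x k)%:P).
have -> : (('X - (x j)%:P) * q)^`().[x j] = q.[x j].
  by rewrite derivM derivXsubC !hornerE subrr mul0r addr0.
by rewrite /q horner_prod; congr `|_|; apply: eq_bigr => k _; rewrite hornerXsubC.
Qed.

(** The squared Vandermonde product is |prod p'(x_j)|; multiplied by the weight
product it is the first member of [disc_identity]. *)
Lemma fekete_energy_value (x : 'I_n -> R) :
  \prod_(j < n) ('X - (x j)%:P) = fekete_poly a s n ->
  sq_energy a s x =
    (2 * a) ^+ (n * n.-1) / desc_prod N n ^+ (2 * n.-1) *
    (\prod_(1 <= k < n.+1) k%:R ^+ k *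
     \prod_(1 <= k < n.+1) (N + 1 - k%:R) ^+ (2 * k - 2) * disc_tail N n) *
    (((2 * a) ^+ n * \prod_(j < n) (N - j%:R) / desc_prod N n) ^+ 2) `^ (- N).
Proof.
move=> xE; have xH := xE; rewrite (fekete_romanovski a0 s1 n2) in xH.
have nN := N_gt s1 n2.
have pos j : (j < 2 * n)%N -> 0 < 2 * N + 1 - j%:R by exact: desc_factor_gt0.
have neq j : (j < 2 * n)%N -> 2 * N + 1 - j%:R != 0.
  by move=> jn; rewrite lt0r_neq0 ?pos.
have [W V] := romanovski_root_products (lt0r_neq0 a0) nN xH.
have D0 : 0 < desc_prod N n.
  by apply: prodr_gt0 => j _; rewrite -addrA -opprD -natrD pos //; have := ltn_ord j; lia.
have WE : a ^+ n * \prod_(1 <= j < n.+1) romanovski_ratio N j =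
   (2 * a) ^+ n * \prod_(j < n) (N - j%:R) / desc_prod N n.
  apply: (mulIf (lt0r_neq0 D0)); rewrite divfK ?lt0r_neq0 //.
  rewrite exprMn -mulrA (prod_romanovski_ratio neq).
  by ring.
rewrite sq_energy_prod // W WE; congr (_ * _).
have q0 j : (j < n)%N -> 0 < romanovski_ratio N j.+1.
  move=> jn; rewrite /romanovski_ratio divr_gt0 //.
    by have := pos j ltac:(lia); rewrite -natr1; lra.
  by have := pos (2 * j)%N ltac:(lia); rewrite natrM -natr1; lra.
have d0 j : (j < n)%N -> 0 < romanovski_lower (a ^+ 2) N j.+1.
  by move=> jn; rewrite /romanovski_lower mulr_gt0 ?q0 // mulr_gt0 ?exprn_gt0.
have W0 : 0 < (a ^+ n * \prod_(1 <= j < n.+1) romanovski_ratio N j) ^+ 2.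
  rewrite exprn_gt0 // mulr_gt0 ?exprn_gt0 // big_add1 /= big_mkord.
  by apply: prodr_gt0 => j _; rewrite q0.
rewrite prod_roots_deriv xH; set V2 := `|_|.
have VE : V2 * (a ^+ n * \prod_(1 <= j < n.+1) romanovski_ratio N j) ^+ 2 =
    romanovski_lower (a ^+ 2) N n ^+ n * \prod_(1 <= j < n) romanovski_rec (a ^+ 2) N j ^+ j.
  rewrite -[X in _ * X]gtr0_norm // -W /V2 -normrM -big_split /= V normrM normr_prod.
  have dn : 0 < romanovski_lower (a ^+ 2) N n.
    by have := d0 n.-1; rewrite (prednK (ltnW n2)); apply.
  rewrite gtr0_norm ?exprn_gt0 //.
  congr (_ * _); apply: eq_big_nat => j /andP[j1 jn].
  rewrite normrX normrN gtr0_norm // /romanovski_rec divr_gt0 //.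
    by have := d0 j.-1; rewrite (prednK j1); apply; lia.
  by rewrite -natrM pos //; lia.
have := @disc_identity _ a N n.-1; rewrite (prednK (ltnW n2)) => /(_ neq); rewrite -VE => DI.
have D1 : desc_prod N n ^+ (2 * n.-1) != 0 by rewrite expf_neq0 // lt0r_neq0.
apply: (mulIf D1); apply: (mulIf (lt0r_neq0 W0)); rewrite mulrAC DI.
by rewrite [in RHS]mulrAC -[_ / _ * _ * _ in RHS]mulrA; field.
Qed.

Let N_pos := N_gt s1 n2.

Lemma int_power_prod :
  \prod_(1 <= k < n.+1) (k%:R ^ (k%:Z - 2 * n%:Z + 2) : R) =
  \prod_(1 <= k < n.+1) k%:R ^+ k / n`!%:R ^+ (2 * n.-1).
Proof.
rewrite fact_prod natr_prod -prodrXl -prodf_div /=.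
apply: eq_big_nat => k /andP[k1 _].
rewrite (_ : k%:Z - 2 * n%:Z + 2 = k%:Z - (2 * n.-1)%:Z); last by lia.
by rewrite expfzDr ?pnatr_eq0 -?lt0n // -invr_expz.
Qed.

(** Both sides are positive and are monomials, with real exponents, in the same
products, so the equality is checked on logarithms. *)
Lemma fekete_diameter_value (x : 'I_n -> R) :
  \prod_(j < n) ('X - (x j)%:P) = fekete_poly a s n ->
  sq_energy a s x `^ (1 / (n%:R * (n%:R - 1))) =
  (2 * a) `^ (1 - 2 * s) * (n`!)%:R `^ (2 / n%:R)
   / `|pochhammer (- s * (n%:R - 1)) n| `^ (2 * s / n%:R)
   * `|pochhammer (n%:R - 2 * s * (n%:R - 1) - 1) n| `^ (2 * (s - 1) / n%:R)
   * (\prod_(1 <= k < n.+1)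
        (k%:R ^ (k%:Z - 2 * n%:Z + 2)
         * `|k%:R - s * (n%:R - 1) - 1| ^+ (2 * k - 2)
         * `|n%:R + k%:R - 2 * s * (n%:R - 1) - 2| ^+ (n - k)))
       `^ (1 / (n%:R * (n%:R - 1))).
Proof.
move=> xE; rewrite (fekete_energy_value xE).
have pos j : (j < 2 * n)%N -> 0 < 2 * N + 1 - j%:R by exact: (desc_factor_gt0 N_pos).
rewrite mulNr -!(mulrA 2 s (n%:R - 1)) pochhammer_desc pochhammer_opp.
rewrite !normrM normrX normrN1 expr1n !mul1r.
have Nj j : (j < n)%N -> 0 < N - j%:R.
  by move=> jn; have := pos (2 * j).+1 ltac:(lia); rewrite -(natr1 (2 * j)) natrM; lra.
have D0 : 0 < desc_prod N n.
  by apply: prodr_gt0 => j _; rewrite -addrA -opprD -natrD pos //; have := ltn_ord j; lia.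
have P0 : 0 < \prod_(j < n) (N - j%:R) by apply: prodr_gt0 => j _; rewrite Nj.
rewrite (gtr0_norm D0) (gtr0_norm P0).
set A := \prod_(1 <= k < n.+1) k%:R ^+ k.
set B := \prod_(1 <= k < n.+1) (N + 1 - k%:R) ^+ (2 * k - 2).
have -> : \prod_(1 <= k < n.+1) (k%:R ^ (k%:Z - 2 * n%:Z + 2)
     * `|k%:R - N - 1| ^+ (2 * k - 2) * `|n%:R + k%:R - 2 * N - 2| ^+ (n - k)) =
   A / n`!%:R ^+ (2 * n.-1) * B * disc_tail N n.
  rewrite /A -int_power_prod -!big_split /=; apply: eq_big_nat => k /andP[k1 kn].
  have e1 : `|k%:R - N - 1| = N + 1 - k%:R.
    rewrite -normrN gtr0_norm; first by ring.
    by have := Nj k.-1 ltac:(lia); rewrite -{2}(prednK k1) -natr1; lra.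
  have e2 : `|n%:R + k%:R - 2 * N - 2| = 2 * N + 2 - n%:R - k%:R.
    rewrite -normrN gtr0_norm; first by ring.
    have := pos (n + k.-1)%N ltac:(lia).
    by rewrite -{2}(prednK k1) -natr1 natrD; lra.
  by rewrite e1 e2.
have A0 : 0 < A.
  by rewrite /A big_add1 big_mkord prodr_gt0 // => k _; rewrite exprn_gt0.
have B0 : 0 < B.
  rewrite /B big_add1 big_mkord prodr_gt0 // => k _; rewrite exprn_gt0 //.
  by have := Nj k (ltn_ord k); rewrite -natr1; lra.
have T0 : 0 < disc_tail N n.
  rewrite /disc_tail big_add1 big_mkord prodr_gt0 // => k _; rewrite exprn_gt0 //.
  have := pos (n + k)%N ltac:(have := ltn_ord k; lia).
  by rewrite -natr1 natrD; lra.
have f0 : 0 < n`!%:R :> R by rewrite ltr0n fact_gt0.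
have a2 : 0 < 2 * a by rewrite mulr_gt0.
have n0 : n%:R != 0 :> R by rewrite pnatr_eq0; lia.
have n1 : n%:R - 1 != 0 :> R by rewrite subr_eq0 (eqr_nat _ n 1); lia.
have m1 : n.-1%:R = n%:R - 1 :> R by rewrite -subn1 natrB //; lia.
move: D0 P0 A0 B0 T0 f0 a2.
move: (desc_prod N n) (\prod_(j < n) _) A B (disc_tail N n) (n`!%:R) (2 * a).
move=> D P A B T f b D0 P0 A0 B0 T0 f0 b0.
have X0 (u v : R) : 0 < u -> 0 < u `^ v by exact: powR_gt0.
apply: ln_inj; rewrite ?posrE.
- by rewrite !(X0, mulr_gt0, invr_gt0, exprn_gt0).
- by rewrite !(X0, mulr_gt0, invr_gt0, exprn_gt0).
have lnMp (u v : R) : 0 < u -> 0 < v -> ln (u * v) = ln u + ln v by move=> *; rewrite lnM ?posrE.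
have lnVp (u : R) : 0 < u -> ln u^-1 = - ln u by move=> *; rewrite lnV ?posrE.
have lnXp (u : R) m : 0 < u -> ln (u ^+ m) = m%:R * ln u by move=> *; rewrite lnXn // mulr_natl.
rewrite !(ln_powR, lnXp, lnMp, lnVp); try by rewrite // !(X0, mulr_gt0, invr_gt0, exprn_gt0).
rewrite !natrM m1; field.
by rewrite n0 n1.
Qed.
End Value.

Local Open Scope classical_set_scope.
Local Open Scope ring_scope.
Local Open Scope complex_scope.

Theorem theorem1p2 (R : realType) (a s : R) (n : nat)
    (ha : 0 < a) (hs : 1 < s) (hn : (2 <= n)%N) :
  let w := fun z : R[i] => normc (z - a%:C * 'i%C) `^ (- s) in
  let G : {poly R[i]} := map_poly (real_complex R) (fekete_poly a s n) in
  let alpha : R := - s * (n%:R - 1) - 1 in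
  [/\ forall F : set R[i],
        weighted_fekete_set n w (real_line R) F <->
        F = [set x : R[i] | root G x],
      forall x : R[i],
        G.[x] = (2 * a%:C * 'i%C) ^+ n * (n`!)%:R
                / (pochhammer (n%:R - 2 * s * (n%:R - 1) - 1) n)%:C
                * (jacobi n alpha%:C alpha%:C).[- 'i%C * x / a%:C]
    & weighted_diameter n w (real_line R) =
      ((2 * a) `^ (1 - 2 * s) * (n`!)%:R `^ (2 / n%:R)
         / `|pochhammer (- s * (n%:R - 1)) n| `^ (2 * s / n%:R)
         * `|pochhammer (n%:R - 2 * s * (n%:R - 1) - 1) n|
             `^ (2 * (s - 1) / n%:R)
         * (\prod_(1 <= k < n.+1)
              (k%:R ^ (k%:Z - 2 * n%:Z + 2)
               * `|k%:R - s * (n%:R - 1) - 1| ^+ (2 * k - 2)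
               * `|n%:R + k%:R - 2 * s * (n%:R - 1) - 2| ^+ (n - k)))
             `^ (1 / (n%:R * (n%:R - 1))))%:E].
Proof.
move=> w G alpha; split.
- exact: fekete_set_iff.
- move=> x; pose f : {rmorphism R -> R[i]} := real_complex R.
  pose N : R := s * (n%:R - 1); pose c := f a * 'i%C.
  have i2 : 'i%C ^+ 2 = -1 :> R[i] by exact: sqr_i.
  have fa0 : f a != 0 by rewrite fmorph_eq0 gt_eqF.
  have i0 : 'i%C != 0 :> R[i] by rewrite -sqrf_eq0 i2 oppr_eq0 oner_eq0.
  have c0 : c != 0 by rewrite mulf_neq0.
  have hN j : (j < 2 * n)%N -> 2 * f N + 1 - j%:R != 0.
    move=> jn; have := lt0r_neq0 (desc_factor_gt0 (N_gt hs hn) jn).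
    by rewrite -(fmorph_eq0 f) !(rmorphB, rmorph_nat, rmorph1, rmorphD, rmorphM).
  have c2 : - c ^+ 2 = f (a ^+ 2) by rewrite exprMn i2 mulrN1 opprK rmorphXn.
  have GE : G = romanovski (- c ^+ 2) (f N) n.
    by rewrite c2 -map_romanovski -(fekete_romanovski ha hs hn).
  have := romanovski_jacobi c0 hN (- 'i%C * x / f a).
  rewrite -GE (_ : c * _ = x); last first.
    transitivity (- 'i%C ^+ 2 * x * (f a / f a)); first by rewrite /c; ring.
    by rewrite i2 opprK mul1r divff // mulr1.
  have -> : - f N - 1 = alpha%:C by rewrite /alpha mulNr rmorphB rmorphN rmorph1.
  have -> : n%:R - 2 * f N - 1 = f (n%:R - 2 * s * (n%:R - 1) - 1).
    by rewrite -mulrA !(rmorphB, rmorph_nat, rmorph1) (rmorphM f 2) rmorph_nat.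
  by rewrite -map_pochhammer -(mulrA 2 a%:C).
have [x [xI xmax]] := sq_energy_max ha hs hn.
rewrite (diameter_maximizer ha hn xI xmax).
by rewrite (fekete_diameter_value ha hs hn (maximizer_poly ha hs hn xI xmax)).
Qed.
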